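(* Let $n\ge2$ and $2<p<\infty$. For every $M>0$, the set of initial data $u^0\in L^2_\sigma$ for which there is a weak solution $u\in M\mathbb{B}_{L^p_tL^2_x}$ of the Cauchy problem for the incompressible Euler equations in $\mathbb{R}^n\times[0,\infty)$, $$\partial_tu+u\cdot\nabla u-\nabla P=0,\qquad\operatorname{div}u=0,\qquad u(\cdot,0)=u^0,$$ is nowhere dense in $L^2_\sigma$. In particular, for a residual $G_\delta$ set of initial data in $L^2_\sigma$, the Cauchy problem has no weak solution in $$L^\infty_tL^2_x\cap\Big[\bigcup_{2<p<\infty}L^p_tL^2_x\Big].$$
   Context: $L^2_\sigma=\{v\in L^2(\mathbb{R}^n,\mathbb{R}^n):\operatorname{div}v=0\}$ with the $L^2$ norm; $L^p_tL^2_x$ denotes $L^p((0,\infty);L^2(\mathbb{R}^n,\mathbb{R}^n))$, and $L^p_tL^2_{\sigma,x}$ its subspace of fields that are divergence-free in $x$. $M\mathbb{B}_Z$ is the closed ball of radius $M$ centred at $0$ in $Z$. Given $u^0\in L^2_\sigma$ and $2\le p\le\infty$, $u\in L^p_tL^2_{\sigma,x}$ is a weak solution of the Cauchy problem if $$\int_0^\infty\int_{\mathbb{R}^n}(u\cdot\partial_t\varphi+u\otimes u:\mathrm{D}\varphi)\,dx\,dt+\int_{\mathbb{R}^n}u^0\cdot\varphi(\cdot,0)\,dx=0$$ for all $\varphi\in C_c^\infty(\mathbb{R}^n\times[0,\infty),\mathbb{R}^n)$ with $\operatorname{div}_x\varphi=0$. *)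

(* Defs.v *)
From HB Require Import structures.
From mathcomp Require Import all_boot all_order all_algebra.
From mathcomp Require Import ring.
From mathcomp Require Import all_classical all_reals all_analysis.
From mathcomp Require Import measurable_realfun borel_hierarchy.
Set Implicit Arguments.
Unset Strict Implicit.
Unset Printing Implicit Defensive.
Import Order.TTheory GRing.Theory Num.Theory.
Import numFieldNormedType.Exports.
Local Open Scope classical_set_scope.
Local Open Scope ring_scope.

(* The product sigma-algebra on R^n = 'rV[R]_n, generated by the coordinate
   maps, as for n.-tuple R; it coincides with the Borel sigma-algebra. *)
Definition rV_display : measure_display.
Proof. exact: default_measure_display. Qed.

Section rV_measurable.
Variables (R : realType) (n : nat).

Definition rV_coord (i : 'I_n) (x : 'rV[R]_n) : R := x 0 i.

HB.instance Definition _ := @isMeasurable.Build rV_display 'rV[R]_n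
  (g_sigma_preimage rV_coord)
  (@sigma_algebra0 _ _ _) (@sigma_algebraC _ _) (@sigma_algebra_bigcup _ _ _).

Lemma measurable_rV_coord (i : 'I_n) : measurable_fun [set: 'rV[R]_n] (rV_coord i).
Proof.
move=> _ Y mY; rewrite setTI; apply: sub_sigma_algebra => /=.
rewrite -bigcup_seq/=; exists i => /=; first by rewrite mem_index_enum.
by exists Y => //; rewrite setTI.
Qed.

Lemma measurable_fun_rV d (T : measurableType d) (f : T -> 'rV[R]_n) :
  (forall i, measurable_fun [set: T] (fun x => f x 0 i)) ->
  measurable_fun [set: T] f.
Proof.
move=> mf _ Y mY; rewrite setTI.
suff : <<s \big[setU/set0]_(i < n) preimage_set_system setT (rV_coord i) measurable >>
    `<=` [set A | measurable (f @^-1` A)] by apply.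
apply: smallest_sub.
  split=> [|A mA|F mF] /=.
  - by rewrite preimage_set0.
  - rewrite setTD preimage_setC; exact: measurableC.
  - rewrite preimage_bigcup; exact: bigcupT_measurable.
rewrite -bigcup_seq => A [i /= _ [B mB <-]] /=.
rewrite setTI -comp_preimage -[X in measurable X]setTI.
exact: mf.
Qed.

End rV_measurable.

Section lebesgue_rV.
Variable R : realType.

Definition rV_cons n (z : R * 'rV[R]_n) : 'rV[R]_n.+1 :=
  (row_mx (const_mx z.1) z.2 : 'rV[R]_(1 + n)).

Lemma measurable_rV_cons n :
  measurable_fun [set: (R * 'rV[R]_n)%type] (@rV_cons n).
Proof.
apply: measurable_fun_rV => i.
rewrite /rV_cons.
have [j ->|j ->] := split_ordP (i : 'I_(1 + n)).
  rewrite [X in measurable_fun _ X](_ : _ = fst)//.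
  apply/funext => z; exact: etrans (@row_mxEl R 1 1 n _ _ _ _) (mxE _ _ _ _).
rewrite [X in measurable_fun _ X](_ : _ = (@rV_coord R n j) \o snd).
  exact: measurableT_comp (@measurable_rV_coord R n j) measurable_snd.
apply/funext => z; exact: (@row_mxEr R 1 1 n).
Qed.

Definition rV_uncons n (x : 'rV[R]_n.+1) : R * 'rV[R]_n :=
  (x 0 0, \row_i x 0 (lift 0 i)).

Lemma rV_consK n : cancel (@rV_cons n) (@rV_uncons n).
Proof.
move=> [a v]; rewrite /rV_uncons /rV_cons; congr pair.
  have -> : 0 = lshift n (0 : 'I_1) :> 'I_(1 + n) by exact: val_inj.
  exact: etrans (@row_mxEl R 1 1 n _ _ _ _) (mxE _ _ _ _).
apply/rowP => i; rewrite mxE.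
have -> : lift 0 i = rshift 1 i :> 'I_(1 + n) by exact: val_inj.
exact: (@row_mxEr R 1 1 n).
Qed.

Lemma measurable_rV_uncons n : measurable_fun [set: 'rV[R]_n.+1] (@rV_uncons n).
Proof.
apply: measurable_fun_pair; first exact: (@measurable_rV_coord R n.+1 0).
apply: measurable_fun_rV => i.
rewrite [X in measurable_fun _ X](_ : _ = @rV_coord R n.+1 (lift 0 i)).
  exact: measurable_rV_coord.
by apply/funext => x; rewrite mxE.
Qed.

Section step.
Variables (n : nat) (mu : {sigma_finite_measure set 'rV[R]_n -> \bar R}).

Definition lebesgue_rVS : set 'rV[R]_n.+1 -> \bar R :=
  pushforward (@lebesgue_measure R \x mu)%E (@rV_cons n).

Let mcons := @measurable_rV_cons n.

Let lebesgue_rVS0 : lebesgue_rVS set0 = 0%E.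
Proof. by rewrite /lebesgue_rVS /pushforward preimage_set0 measure0. Qed.

Let lebesgue_rVS_ge0 A : (0 <= lebesgue_rVS A)%E.
Proof. exact: measure_ge0. Qed.

Let lebesgue_rVS_sigma_additive : semi_sigma_additive lebesgue_rVS.
Proof.
exact: (@measure_semi_sigma_additive _ _ _
  (pushforward (@lebesgue_measure R \x mu)%E (@rV_cons n))).
Qed.

HB.instance Definition _ := isMeasure.Build _ _ _ lebesgue_rVS
  lebesgue_rVS0 lebesgue_rVS_ge0 lebesgue_rVS_sigma_additive.

Let lebesgue_rVS_sigma_finite : sigma_finite setT lebesgue_rVS.
Proof.
have /sigma_finiteP[F [TF ndF Foo]] := sigma_finiteT (@lebesgue_measure R).
have /sigma_finiteP[G [TG ndG Goo]] := sigma_finiteT mu.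
exists (fun k => @rV_uncons n @^-1` (F k `*` G k)).
  rewrite -preimage_bigcup [X in _ @^-1` X](_ : _ = setT) ?preimage_setT//.
  apply/seteqP; split => // -[a v] _.
  have [i _ Fa] : (\bigcup_k F k) a by rewrite -TF.
  have [j _ Gv] : (\bigcup_k G k) v by rewrite -TG.
  exists (maxn i j) => //; split => /=.
  - by move: a Fa; exact/subsetPset/ndF/leq_maxl.
  - by move: v Gv; exact/subsetPset/ndG/leq_maxr.
move=> k; have [mF Fk] := Foo k; have [mG Gk] := Goo k.
have mFG : measurable (F k `*` G k) by exact: measurableX.
split; first by rewrite -[X in measurable X]setTI; exact: measurable_rV_uncons.
rewrite /lebesgue_rVS /pushforward -comp_preimage.
rewrite (_ : _ \o _ = id); last by apply/funext => z; exact: rV_consK.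
by rewrite product_measure1E// lte_mul_pinfty// ge0_fin_numE.
Qed.

HB.instance Definition _ := Measure_isSigmaFinite.Build _ _ _ lebesgue_rVS
  lebesgue_rVS_sigma_finite.

End step.

(* Lebesgue measure on R^n, as the n-fold product of Lebesgue measure on R. *)
Fixpoint lebesgue_rV (n : nat) : {sigma_finite_measure set 'rV[R]_n -> \bar R} :=
  match n return {sigma_finite_measure set 'rV[R]_n -> \bar R} with
  | 0 => \d_ (0 : 'rV[R]_0)
  | m.+1 => lebesgue_rVS (lebesgue_rV m)
  end.

End lebesgue_rV.

Section euclidean.
Variables (R : realType) (n : nat).
Implicit Types a b : 'rV[R]_n.

Definition dot a b : R := \sum_i a 0 i * b 0 i.

(* The Euclidean norm; `|a| is the supremum norm in the library. *)
Definition enorm a : R := Num.sqrt (dot a a).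

Lemma dotxx_ge0 a : 0 <= dot a a.
Proof. by apply: sumr_ge0 => i _; rewrite -expr2 sqr_ge0. Qed.

Lemma enorm_ge0 a : 0 <= enorm a. Proof. exact: sqrtr_ge0. Qed.

Lemma sqr_enorm a : enorm a ^+ 2 = dot a a.
Proof. by rewrite sqr_sqrtr// dotxx_ge0. Qed.

Lemma enorm_eq0 a : enorm a = 0 -> a = 0.
Proof.
move=> a0; have := sqr_enorm a; rewrite a0 expr0n/= => /esym/eqP.
rewrite psumr_eq0 => [/allP h|i _]; last by rewrite -expr2 sqr_ge0.
apply/rowP => i; have := h i (mem_index_enum i).
by rewrite implyTb -expr2 sqrf_eq0 mxE => /eqP.
Qed.

Lemma enorm0 : enorm 0 = 0.
Proof.
by rewrite /enorm /dot big1 ?sqrtr0// => i _; rewrite mxE mul0r.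
Qed.

Lemma enormN a : enorm (- a) = enorm a.
Proof. by congr Num.sqrt; apply: eq_bigr => i _; rewrite mxE mulrNN. Qed.

Lemma dot_le a b : dot a b <= enorm a * enorm b.
Proof.
apply: le_trans (ler_norm _) _.
rewrite -(ler_pXn2r (ltn0Sn 1)) ?nnegrE ?mulr_ge0 ?enorm_ge0//.
rewrite exprMn !sqr_enorm real_normK ?num_real// -subr_ge0.
have -> : dot a a * dot b b - dot a b ^+ 2 =
    2^-1 * \sum_i \sum_j (a 0 i * b 0 j - a 0 j * b 0 i) ^+ 2.
  transitivity (2^-1 * (\sum_i \sum_j (a 0 i * a 0 i) * (b 0 j * b 0 j) +
      \sum_i \sum_j (a 0 j * a 0 j) * (b 0 i * b 0 i)
    - 2 * \sum_i \sum_j (a 0 i * b 0 i) * (a 0 j * b 0 j))).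
    rewrite [X in _ + X - _]exchange_big/=.
    have E (f g : 'I_n -> R) : \sum_i \sum_j f i * g j = (\sum_i f i) * (\sum_i g i).
      by rewrite mulr_suml; apply: eq_bigr => i _; rewrite mulr_sumr.
    rewrite (E (fun i => a 0 i * a 0 i) (fun i => b 0 i * b 0 i)).
    rewrite (E (fun i => a 0 i * b 0 i) (fun i => a 0 i * b 0 i)).
    rewrite -/(dot a a) -/(dot b b) -/(dot a b).
    by field.
  rewrite mulr_sumr -big_split/= -sumrB; congr (_ * _); apply: eq_bigr => i _.
  rewrite mulr_sumr -big_split/= -sumrB; apply: eq_bigr => j _.
  by ring.
by rewrite mulr_ge0// sumr_ge0// => i _; rewrite sumr_ge0// => j _; rewrite sqr_ge0.
Qed.

Lemma enormD a b : enorm (a + b) <= enorm a + enorm b.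
Proof.
rewrite -(ler_pXn2r (ltn0Sn 1)) ?nnegrE ?addr_ge0 ?enorm_ge0//.
rewrite sqrrD !sqr_enorm.
have -> : dot (a + b) (a + b) = dot a a + dot a b *+ 2 + dot b b.
  rewrite /dot -sumrMnl -!big_split/=; apply: eq_bigr => i _.
  by rewrite mxE; ring.
by rewrite lerD2r lerD2l lerMn2r/= dot_le.
Qed.

Lemma measurable_enorm : measurable_fun [set: 'rV[R]_n] enorm.
Proof.
apply: (@measurableT_comp _ _ _ _ _ _ (@Num.sqrt R)).
  apply: continuous_measurable_fun; exact: sqrt_continuous.
apply: measurable_sum => i.
by apply: measurable_funM; exact: (@measurable_rV_coord R n i).
Qed.

End euclidean.

Section smooth.
Variables (R : realType) (V W : normedModType R).

(* C^oo: every iterated directional derivative of f exists and is Frechet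
   differentiable (hence continuous) at every point. *)
Definition smooth (f : V -> W) : Prop :=
  forall (vs : seq V) (x : V), differentiable (foldr (fun v g => 'D_v g) f vs) x.

Definition compact_support (f : V -> W) : Prop :=
  compact (closure [set x | f x != 0]).

End smooth.

Section L2.
Variables (R : realType) (n : nat).
Implicit Types v w z : 'rV[R]_n -> 'rV[R]_n.

Definition L2norm v : \bar R :=
  ('N[lebesgue_rV R n]_2%:E[EFin \o (fun x => enorm (v x))])%E.

(* div v = 0 in the sense of distributions on R^n *)
Definition div_free v : Prop :=
  forall psi : 'rV[R]_n -> R, smooth psi -> compact_support psi ->
    \int[lebesgue_rV R n]_x \sum_i v x 0 i * 'D_(delta_mx 0 i) psi x = 0.

Record L2sigma : Type := MkL2sigma {
  L2sigma_val :> {mfun_(lebesgue_rV R n), 'rV[R]_n >-> 'rV[R]_n};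
  L2sigma_norm : (L2norm L2sigma_val < +oo)%E;
  L2sigma_div : div_free L2sigma_val }.

HB.instance Definition _ := gen_eqMixin L2sigma.
HB.instance Definition _ := gen_choiceMixin L2sigma.

Lemma measurable_L2sigma (u : L2sigma) : measurable_fun [set: 'rV[R]_n] u.
Proof. by rewrite /= /aqEqMfun_to_fun. Qed.

Lemma L2norm_ge0 v : (0 <= L2norm v)%E.
Proof. exact: Lnorm_ge0. Qed.

Lemma measurable_rVB v w : measurable_fun setT v -> measurable_fun setT w ->
  measurable_fun setT (fun x => v x - w x).
Proof.
move=> mv mw; apply: measurable_fun_rV => i.
rewrite [X in measurable_fun _ X](_ : _ =
    (rV_coord i \o v) \- (rV_coord i \o w)); last first.
  by apply/funext => x; rewrite /= !mxE.
by apply: measurable_funB;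
  exact: measurableT_comp (@measurable_rV_coord R n i) _.
Qed.

Lemma measurable_rVN v : measurable_fun setT v ->
  measurable_fun setT (fun x => - v x).
Proof.
move=> mv; rewrite [X in measurable_fun _ X](_ : _ = fun x => 0 - v x).
  exact: measurable_rVB (measurable_cst _) mv.
by apply/funext => x; rewrite sub0r.
Qed.

Lemma le_L2norm (f g : 'rV[R]_n -> R) :
  measurable_fun setT f -> measurable_fun setT g ->
  (forall x, 0 <= f x <= g x) ->
  ('N[lebesgue_rV R n]_2%:E[EFin \o f] <= 'N[lebesgue_rV R n]_2%:E[EFin \o g])%E.
Proof.
move=> mf mg fg; rewrite unlock /Lnorm gt0_ler_poweR//.
- by rewrite in_itv/= leey integral_ge0.
- by rewrite in_itv/= leey integral_ge0.
have mp (h : 'rV[R]_n -> R) : measurable_fun setT h ->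
    measurable_fun setT (fun x => (`|(EFin \o h) x| `^ 2)%E : \bar R).
  move=> mh; apply: (measurableT_comp (measurable_poweR _)) => //.
  by apply: measurableT_comp => //; exact/measurable_EFinP.
apply: ge0_le_integral => //; [by move=> x _; exact: poweR_ge0|exact: mp|exact: mp|].
move=> x _; have /andP[f0 fgx] := fg x.
rewrite gt0_ler_poweR//.
- by rewrite in_itv/= leey andbT lee_fin.
- by rewrite in_itv/= leey andbT lee_fin.
- by rewrite /= lee_fin !ger0_norm// (le_trans f0).
Qed.

Lemma L2normB v w z : measurable_fun setT v -> measurable_fun setT w ->
    measurable_fun setT z ->
  (L2norm (fun x => v x - z x)%R <=
   L2norm (fun x => v x - w x)%R + L2norm (fun x => w x - z x)%R)%E.
Proof.
move=> mv mw mz.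
have me (f : 'rV[R]_n -> 'rV[R]_n) : measurable_fun setT f -> measurable_fun setT (fun x => enorm (f x)).
  by move=> mf; exact: measurableT_comp (@measurable_enorm R n) mf.
have mvw := me _ (measurable_rVB mv mw).
have mwz := me _ (measurable_rVB mw mz).
apply: le_trans (eminkowski _ mvw mwz _); last by rewrite lee_fin ler1n.
apply: le_L2norm; [exact: me _ (measurable_rVB mv mz)|exact: measurable_funD|].
move=> x; rewrite enorm_ge0/=.
by rewrite (le_trans _ (enormD _ _))// addrA subrK.
Qed.

Definition L2sigma_dist (u v : L2sigma) : R := fine (L2norm (fun x => u x - v x)).

Let L2sigma_distN (u v : L2sigma) :
  L2norm (fun x => u x - v x) = L2norm (fun x => v x - u x).
Proof.
congr Lnorm; apply/funext => x /=; congr EFin.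
by rewrite -enormN opprB.
Qed.

Let L2sigma_distE (u v : L2sigma) :
  (L2sigma_dist u v)%:E = L2norm (fun x => u x - v x).
Proof.
rewrite /L2sigma_dist fineK// ge0_fin_numE ?L2norm_ge0//.
have m0 : measurable_fun [set: 'rV[R]_n] (fun _ => 0 : 'rV[R]_n).
  exact: measurable_cst.
apply: le_lt_trans (L2normB (measurable_L2sigma u) m0 (measurable_L2sigma v)) _.
apply: lte_add_pinfty.
  rewrite (_ : (fun x => u x - 0) = u); first exact: L2sigma_norm.
  by apply/funext => x; rewrite subr0.
rewrite (_ : L2norm _ = L2norm v); first exact: L2sigma_norm.
by congr Lnorm; apply/funext => x /=; rewrite sub0r enormN.
Qed.

Let L2sigma_distxx u : L2sigma_dist u u = 0.
Proof.
rewrite /L2sigma_dist /L2norm (_ : _ \o _ = cst 0%E) ?Lnorm0//.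
by apply/funext => x /=; rewrite subrr enorm0.
Qed.

Let L2sigma_dist_eq0 (u v : L2sigma) : L2sigma_dist u v = 0 -> u = v.
Proof.
move=> uv0.
have uv : L2sigma_val u = L2sigma_val v.
  have h : L2norm (fun x => u x - v x) = 0%E by rewrite -L2sigma_distE uv0.
  have me : measurable_fun [set: 'rV[R]_n] (EFin \o (fun x => enorm (u x - v x))).
    apply/measurable_EFinP; apply: measurableT_comp (@measurable_enorm R n) _.
    by apply: measurable_rVB; exact: measurable_L2sigma.
  have := Lnorm_eq0_eq0 me _ h; rewrite lte_fin => /(_ (ltr0n _ _)) H.
  rewrite -(reprK (L2sigma_val u)) -(reprK (L2sigma_val v)).
  apply/eqmodP/asboolP.
  apply: filterS H => x /(_ Logic.I) [] /= /enorm_eq0 /eqP.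
  by rewrite subr_eq0 => /eqP.
move: u v uv {uv0} => [u nu du] [v nv dv] /= uv.
by move: nu du; rewrite uv => nu du; congr MkL2sigma; exact: Prop_irrelevance.
Qed.

Let L2sigma_dist_sym (u v : L2sigma) : L2sigma_dist u v = L2sigma_dist v u.
Proof. by rewrite /L2sigma_dist L2sigma_distN. Qed.

Let L2sigma_dist_triangle (v u w : L2sigma) :
  L2sigma_dist u w <= L2sigma_dist u v + L2sigma_dist v w.
Proof.
rewrite -lee_fin EFinD !L2sigma_distE.
by apply: L2normB; exact: measurable_L2sigma.
Qed.

HB.instance Definition _ := @isMetric.Build R L2sigma L2sigma_dist
  L2sigma_distxx L2sigma_dist_eq0 L2sigma_dist_sym L2sigma_dist_triangle.

End L2.

Section bochner.
Variables (R : realType) (n : nat).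
Implicit Types u : R -> 'rV[R]_n -> 'rV[R]_n.

Definition lebesgue_pos : {measure set (measurableTypeR R) -> \bar R} :=
  mrestr (@lebesgue_measure R) (measurable_itv (`]0, +oo[ : interval R)).

(* Norm of L^p((0,oo); L^2(R^n,R^n)), for p in [1,+oo]. *)
Definition LpL2_norm (p : \bar R) u : \bar R :=
  ('N[lebesgue_pos]_p[@L2norm R n \o u])%E.

(* Elements of the Bochner space L^p((0,oo); L^2) are given by jointly
   measurable representatives; the values at times t <= 0 are irrelevant. *)
Definition LpL2 (p : \bar R) u : Prop :=
  measurable_fun [set: (R * 'rV[R]_n)%type] (fun z => u z.1 z.2) /\
  (LpL2_norm p u < +oo)%E.

Definition LpL2_ball (p : \bar R) (M : R) u : Prop :=
  LpL2 p u /\ (LpL2_norm p u <= M%:E)%E.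

Definition LpL2sigma (p : \bar R) u : Prop :=
  LpL2 p u /\ {ae lebesgue_pos, forall t, div_free (u t)}.

End bochner.

Section euler.
Variables (R : realType) (n : nat).
Implicit Types (u : R -> 'rV[R]_n -> 'rV[R]_n) (phi : 'rV[R]_n * R -> 'rV[R]_n).

Definition partial_t phi (z : 'rV[R]_n * R) : 'rV[R]_n := 'D_(0, 1) phi z.

Definition partial_x (j : 'I_n) phi (z : 'rV[R]_n * R) : 'rV[R]_n :=
  'D_(delta_mx 0 j, 0) phi z.

Definition div_x phi (z : 'rV[R]_n * R) : R := \sum_i partial_x i phi z 0 i.

(* Test functions in C_c^oo(R^n x [0,oo), R^n) are the restrictions to t >= 0 of
   functions in C_c^oo(R^n x R, R^n), and only their values at t >= 0 are
   constrained and used.  With (D phi)_ij = d_j phi_i, the term u (x) u : D phi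
   is \sum_i \sum_j u_i u_j d_j phi_i. *)
Definition weak_form u (u0 : 'rV[R]_n -> 'rV[R]_n) phi : R :=
  \int[@lebesgue_measure R]_(t in `]0, +oo[%classic)
    (\int[lebesgue_rV R n]_x
      (dot (u t x) (partial_t phi (x, t)) +
       \sum_i \sum_j u t x 0 i * u t x 0 j * partial_x j phi (x, t) 0 i)) +
  \int[lebesgue_rV R n]_x dot (u0 x) (phi (x, 0)).

Definition weak_solution (u0 : L2sigma R n) u : Prop :=
  (exists p : \bar R, (2%:E <= p)%E /\ LpL2sigma p u) /\
  forall phi : 'rV[R]_n * R -> 'rV[R]_n,
    smooth phi -> compact_support phi ->
    (forall x t, 0 <= t -> div_x phi (x, t) = 0) ->
    weak_form u u0 phi = 0.

End euler.

Section baire_category.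
Variable T : topologicalType.
Implicit Type A : set T.

Definition nowhere_dense A : Prop := interior (closure A) = set0.

Definition meagre A : Prop :=
  exists F : (set T)^nat, (forall k, nowhere_dense (F k)) /\ A `<=` \bigcup_k F k.

Definition residual A : Prop := meagre (~` A).

End baire_category.

(* Main.v *)
Require Import Defs.
From HB Require Import structures.
From mathcomp Require Import all_boot all_order all_algebra.
From mathcomp Require Import ring lra.
From mathcomp Require Import all_classical all_reals all_analysis.
From mathcomp Require Import measurable_realfun borel_hierarchy ess_sup_inf.
Import Order.TTheory GRing.Theory Num.Theory.
Import numFieldNormedType.Exports.
Local Open Scope classical_set_scope.
Local Open Scope ring_scope.

(** A weak solution is tested against [phi (x, t) = chi t *: psi x], where
    [psi] is a divergence-free test field on R^n and [chi] is a time cutoff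
    at scale [tau] with [chi 0 = exp (-1)].  If [u] has norm at most [M] in
    L^p_t L^2_x and initial datum [u0], this gives
    [[
      chi 0 * | int u0 . psi | <=
        int_0^tau |chi'| |int u . psi| dt
        + int_0^tau chi |int u (x) u : D psi| dt,
    ]]
    and with [int |psi|^2 = 1] the first term is small as soon as [tau] is
    large, uniformly in [u] and [psi]; the second is at most a constant,
    depending on [n], [M], [p] and [tau], times [sup |D psi|].  Hence, given
    [d > 0], one first takes [tau] large and then [psi] of unit norm so spread
    out that [sup |D psi|] is tiny: every datum in the set under
    consideration satisfies [| int u0 . psi | <= d] for this one [psi]
    ([exists_small_pairing]).  This inequality survives in the closure, up to
    a factor 2, and is incompatible with the closure containing a ball of
    radius [r] when [d] is small compared with [r], since moving from the
    centre by [(r / 2) psi] changes the pairing by [r / 2]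
    ([nowhere_dense_admissible_data]).

    The fields [psi] are planar vortices
    [kappa * h (1 - |x|^2 / L^2) * (- x_1 e_0 + x_0 e_1)], with [h] the flat
    function equal to [exp (- 1 / y)] for [y > 0] and to [0] for [y <= 0]; as
    [L] grows and [kappa] normalizes the norm, the entries of the
    gradient are at most [5 * kappa] and [kappa] tends to [0] ([exists_normalized_vortex]).  Their
    smoothness is obtained from an inductively defined class of functions
    closed under directional derivatives ([smooth_elem_rV]); that they are
    divergence-free in the sense of distributions follows from the vanishing
    of integrals of partial derivatives of compactly supported functions
    ([integral_partial0]), proved by induction on the dimension with Fubini's
    theorem.

    For the second assertion, a field in both L^oo_t L^2_x and L^p_t L^2_x is
    in L^q_t L^2_x for all [q >= p] ([LpL2_higher]), so integer exponents and
    radii suffice, and [G] is the intersection of countably many complements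
    of closures of nowhere dense sets ([residual_no_weak_solution]). *)

Set Implicit Arguments.
Unset Strict Implicit.
Unset Printing Implicit Defensive.

(** * Flat functions on the line *)

Section flat.
Variable R : realType.
Implicit Types (p : {poly R}) (y z : R).

(** [p (1 / y) * exp (- 1 / y)] for [y > 0], extended by [0]; these functions are
    smooth on the whole line, and [flat 1] is the usual building block of bump
    functions. *)
Definition flat p y : R := if 0 < y then p.[y^-1] * expR (- y^-1) else 0.

Lemma flat_le0 p y : y <= 0 -> flat p y = 0.
Proof. by rewrite /flat leNgt => /negbTE ->. Qed.

Lemma exprn_expRN_le i z : 0 <= z -> z ^+ i * expR (- z) <= i`!%:R.
Proof.
move=> z0; rewrite expRN ler_pdivrMr ?expR_gt0//.
case: i => [|i]; first by rewrite expr0 fact0 mul1r -expR0 ler_expR.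
have := expR_ge1Dxn i z0 => h.
rewrite mulrC -ler_pdivrMr ?ltr0n ?fact_gt0//.
by rewrite (le_trans _ h)// lerDr.
Qed.

Lemma flat_bounded p : exists2 C, 0 <= C & forall y, `|flat p y| <= C.
Proof.
exists (\sum_(i < size p) `|p`_i| * i`!%:R).
  by apply: sumr_ge0 => i _; rewrite mulr_ge0// ler0n.
move=> y; rewrite /flat; case: ifPn => [y0|_]; last first.
  by rewrite normr0 sumr_ge0// => i _; rewrite mulr_ge0// ler0n.
have z0 : 0 <= y^-1 by rewrite invr_ge0 ltW.
rewrite horner_coef mulr_suml (le_trans (ler_norm_sum _ _ _))// ler_sum// => i _.
rewrite -mulrA normrM ler_wpM2l// ger0_norm ?exprn_expRN_le//.
by rewrite mulr_ge0 ?exprn_ge0 ?expR_ge0.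
Qed.

(** The derivative of [flat p] is [flat (dflat p)]. *)
Definition dflat p : {poly R} := 'X^2 * (p - p^`()).

(** The polynomial can absorb any power of [1 / y], so [flat p] is [O(y ^ 2)] at the
    origin and its derivative there is [0]. *)
Lemma flat_sqr p y : flat p y = y ^+ 2 * flat ('X^2 * p) y.
Proof.
rewrite /flat; case: ifPn => y0; last by rewrite mulr0.
by rewrite hornerM hornerXn; field; rewrite gt_eqF.
Qed.

Global Instance is_derive_flat p y : is_derive y 1 (flat p) (flat (dflat p) y).
Proof.
have [y0|y0|->] := ltgtP y 0.
- rewrite (flat_le0 _ (ltW y0)).
  apply: (@near_eq_is_derive _ _ _ (cst 0)).
  near=> t; rewrite /= flat_le0//.
  by apply/ltW; near: t; exact: lt_nbhsl.
- have yn0 : y != 0 by rewrite gt_eqF.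
  suff : is_derive y 1 (fun t => p.[t^-1] * expR (- t^-1)) (flat (dflat p) y).
    apply: near_eq_is_derive.
    near=> t; rewrite /flat ifT//.
    by near: t; exact: lt_nbhsr.
  pose inv := fun t : R => t^-1.
  have dinv : is_derive y 1 inv (- y ^- 2 *: 1).
    exact: (@is_deriveV _ id).
  have d1 : is_derive y 1 (horner p \o inv) (p^`().[inv y] * (- y ^- 2 *: 1)).
    exact: is_derive1_comp.
  have d2 : is_derive y 1 (expR \o (- inv)) (expR ((- inv) y) * - (- y ^- 2 *: 1)).
    exact: is_derive1_comp.
  have := is_deriveM d1 d2.
  rewrite (_ : (horner p \o inv) * _ = (fun t => p.[t^-1] * expR (- t^-1)))//.
  move/is_derive_eq; apply.
  rewrite /flat y0 /dflat hornerM hornerXn hornerD hornerN /= /inv.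
  rewrite !fctE /= /GRing.scale/= exprVn.
  by field.
- rewrite flat_le0//.
  have [C C0 hC] := flat_bounded ('X^2 * p).
  have H : (fun h : R => h^-1 *: ((flat p \o shift 0) (h *: 1) - flat p 0))
      @ 0^' --> (0 : R).
    apply/cvgr0Pnorm_le => e e0.
    near=> h.
    have hn0 : h != 0 by near: h; exact: nbhs_dnbhs_neq.
    rewrite /= addr0 /GRing.scale/= mulr1 (@flat_le0 p 0)// subr0.
    rewrite flat_sqr expr2 !mulrA mulVf// mul1r normrM.
    apply: (@le_trans _ _ (`|h| * (C + 1))).
      by rewrite ler_wpM2l// (le_trans (hC _))// lerDl.
    rewrite -ler_pdivlMr ?ltr_wpDl//; apply/ltW.
    near: h; apply: dnbhs0_lt.
    by rewrite divr_gt0 ?ltr_wpDl.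
  split; first by apply/cvg_ex; exists 0.
  exact: cvg_lim H.
Unshelve. all: by end_near. Qed.

Lemma differentiable_flat p y : differentiable (flat p) y.
Proof. by apply/derivable1_diffP. Qed.

Lemma flat1_ge0 y : 0 <= flat 1 y.
Proof. by rewrite /flat; case: ifP => // _; rewrite hornerC mul1r expR_ge0. Qed.

Lemma flat1_le1 y : flat 1 y <= 1.
Proof.
rewrite /flat; case: ifPn => // y0.
by rewrite hornerC mul1r -expR0 ler_expR oppr_le0 invr_ge0 ltW.
Qed.

Lemma normr_dflat1 y : `|flat (dflat 1) y| <= 2.
Proof.
rewrite /flat; case: ifPn => [y0|]; last by rewrite normr0.
rewrite /dflat derivC subr0 mulr1 hornerXn.
have z0 : 0 <= y^-1 by rewrite invr_ge0 ltW.
have := exprn_expRN_le 2 z0.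
by rewrite ger0_norm// mulr_ge0 ?exprn_ge0 ?expR_ge0.
Qed.

Lemma flat1_nd x y : x <= y -> flat 1 x <= flat 1 y.
Proof.
move=> xy; have [x0|x0] := leP x 0; first by rewrite (flat_le0 _ x0) flat1_ge0.
have y0 : 0 < y by exact: lt_le_trans xy.
by rewrite /flat x0 y0 !hornerC !mul1r ler_expR lerN2 lef_pV2.
Qed.

Lemma flat1_gt0 y : 0 < y -> 0 < flat 1 y.
Proof. by rewrite /flat => ->; rewrite hornerC mul1r expR_gt0. Qed.

End flat.

(** * A class of smooth functions *)

Section elementary.
Variables (R : realType) (V : normedModType R).
Implicit Types (f g : V -> R) (v x : V).

(** Real functions obtained by sums, products and composition with flat functions
    from differentiable functions with constant directional derivatives.  The class is closed under directional
    derivatives, which makes its members smooth. *)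
Inductive elementary : (V -> R) -> Prop :=
| elem_affine f : (forall x, differentiable f x) ->
    (forall v, exists c, 'D_v f = cst c) -> elementary f
| elem_add f g : elementary f -> elementary g -> elementary (f \+ g)
| elem_mul f g : elementary f -> elementary g -> elementary (f \* g)
| elem_flat p f : elementary f -> elementary (flat p \o f).

Lemma elem_cst c : elementary (cst c).
Proof.
apply: elem_affine => [x|v]; first exact: differentiable_cst.
by exists 0; apply/funext => x; rewrite derive_cst.
Qed.

Lemma elem_linear (l : {linear V -> R}) : continuous l -> elementary l.
Proof.
move=> cl; apply: elem_affine => [x|v]; first exact: linear_differentiable.
exists (l v); apply/funext => x.
rewrite deriveE; last exact: linear_differentiable.
by rewrite diff_lin.
Qed.

Lemma elem_opp f : elementary f -> elementary (\- f).
Proof.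
move=> ef; rewrite (_ : \- f = cst (-1) \* f).
  by apply: elem_mul => //; exact: elem_cst.
by apply/funext => x /=; rewrite mulN1r.
Qed.

Lemma elem_sum n (F : 'I_n -> V -> R) : (forall i, elementary (F i)) ->
  elementary (fun x => \sum_i F i x).
Proof.
elim: n F => [|n IH] F eF.
  rewrite (_ : (fun _ => _) = cst 0); first exact: elem_cst.
  by apply/funext => x; rewrite big_ord0.
rewrite (_ : (fun _ => _) = (fun x => \sum_(i < n) F (widen_ord (leqnSn n) i) x) \+ F ord_max).
  by apply: elem_add => //; exact: IH.
by apply/funext => x; rewrite big_ord_recr.
Qed.

Lemma differentiable_elem f x : elementary f -> differentiable f x.
Proof.
elim=> [{}f //|{}f g _ df _ dg|{}f g _ df _ dg|p {}f _ df].
- exact: differentiableD.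
- exact: differentiableM.
- by apply: differentiable_comp => //; exact: differentiable_flat.
Qed.

(** The chain rule for directional derivatives, obtained by restriction to the
    line through [x] directed by [v]. *)
Lemma is_derive_flat_comp p f x v df : is_derive x v f df ->
  is_derive x v (flat p \o f) (flat (dflat p) (f x) * df).
Proof.
move=> [fx <-].
have der1 (h : V -> R) : 'D_v h x = 'D_1 (fun t : R => h (t *: v + x)) 0.
  rewrite /derive; set g1 := fun t => t^-1 *: _; set g2 := fun t => t^-1 *: _.
  suff -> : g1 = g2 by [].
  apply/funext => t; rewrite /g1 /g2 /=.
  by rewrite addr0 scale0r add0r [_%:A]mulr1.
pose h := fun t : R => f (t *: v + x).
have dh : is_derive (0 : R) 1 h ('D_v f x).
  by split; [exact: ((derivable1P _ _ _).1 fx)|rewrite der1].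
have h0 : h 0 = f x by rewrite /h scale0r add0r.
have H : is_derive (0 : R) 1 (flat p \o h) (flat (dflat p) (f x) * 'D_v f x).
  by rewrite -h0; exact: (@is_derive1_comp _ (flat p) h 0 _ _ (is_derive_flat p (h 0)) dh).
split; first exact: ((derivable1P _ _ _).2 (@ex_derive _ _ _ _ _ _ _ H)).
by rewrite der1; exact: (@derive_val _ _ _ _ _ _ _ H).
Qed.

Lemma elem_derive f v : elementary f -> elementary ('D_v f).
Proof.
have D g x : elementary g -> derivable g x v.
  by move=> eg; apply: diff_derivable; exact: differentiable_elem.
elim=> [{}f _ /(_ v)[c ->]|{}f g ef edf eg edg|{}f g ef edf eg edg|p {}f ef edf].
- exact: elem_cst.
- rewrite (_ : 'D_v _ = 'D_v f \+ 'D_v g); first exact: elem_add.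
  by apply/funext => x; rewrite deriveD//; exact: D.
- rewrite (_ : 'D_v _ = (f \* 'D_v g) \+ (g \* 'D_v f)).
    by apply: elem_add; exact: elem_mul.
  by apply/funext => x; rewrite deriveM//; exact: D.
- rewrite (_ : 'D_v _ = (flat (dflat p) \o f) \* 'D_v f).
    by apply: elem_mul => //; exact: elem_flat.
  apply/funext => x; apply: derive_val.
  by apply: is_derive_flat_comp; apply: derivableP; exact: D.
Qed.

Lemma smooth_elem_rV n (F : V -> 'rV[R]_n) :
  (forall i, elementary (fun x => F x 0 i)) -> smooth F.
Proof.
move=> eF vs x.
have diffF (G : V -> 'rV[R]_n) y : (forall i, elementary (fun z => G z 0 i)) ->
    differentiable G y.
  move=> eG.
  rewrite (_ : G = \sum_i (fun z => G z 0 i *: delta_mx 0 i)).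
    apply: differentiable_sum => i; apply: differentiableZl.
    exact: differentiable_elem.
  apply/funext => z; rewrite [LHS]row_sum_delta fct_sumE.
  by apply: eq_bigr.
apply: (diffF _ _) => {x}; elim: vs => [//|v vs IH] i /=.
have := elem_derive v (IH i).
rewrite (_ : 'D_v (fun _ => _) = (fun x : V =>
  'D_v (foldr (fun v (g : V -> 'rV[R]_n) => 'D_v g) F vs) x 0 i))//.
apply/funext => y; rewrite derive_mx ?mxE//.
by apply: diff_derivable; exact: diffF.
Qed.

End elementary.

Section elementary_coordinates.
Variable R : realType.

Lemma elem_coord n i : elementary (fun x : 'rV[R]_n => x 0 i).
Proof.
pose f (x : 'rV[R]_n) : R := x 0 i.
have lf : linear f by move=> a u v; rewrite /f !mxE.
pose lM := GRing.isLinear.Build _ _ _ _ _ lf.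
pose l : {linear _ -> _} := HB.pack f lM.
by apply: (@elem_linear _ _ l) => x; exact: coord_continuous.
Qed.

Lemma elem_id : elementary (id : R -> R).
Proof.
apply: elem_affine => [x //|v]; exists v; apply/funext => x.
by rewrite derive_id.
Qed.

Lemma elem_precomp (V W : normedModType R) (l : {linear W -> V}) (f : V -> R) :
  continuous l -> elementary f -> elementary (f \o l).
Proof.
move=> cl.
have dl x : differentiable l x by exact: linear_differentiable.
elim=> [{}f df cf|{}f g _ ef _ eg|{}f g _ ef _ eg|p {}f _ ef].
- apply: elem_affine => [x|v]; first exact: differentiable_comp.
  have [c fc] := cf (l v); exists c; apply/funext => x.
  rewrite deriveE; last exact: differentiable_comp.
  by rewrite diff_comp//= diff_lin// -deriveE// -[RHS]/(cst c (l x)) -fc.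
- exact: elem_add.
- exact: elem_mul.
- exact: elem_flat.
Qed.

End elementary_coordinates.

(** * Borel sets and boxes in R^n *)

Section rV_borel.
Variables (R : realType) (n : nat).

Lemma measurable_rV_ball (x : 'rV[R]_n) e : measurable (ball x e).
Proof.
have [e0|e0] := leP e 0.
  rewrite (_ : ball x e = set0)//; apply/seteqP; split => // y [/lt_le_trans/(_ e0)].
  by rewrite ltxx.
rewrite (_ : ball x e = \bigcap_(i in [set: 'I_n]) (@rV_coord R n i @^-1` ball (x 0 i) e)).
  apply: fin_bigcap_measurable => // i _; rewrite -[X in measurable X]setTI.
  by apply: measurable_rV_coord => //; exact: measurable_ball.
apply/seteqP; split => y /= h; first by move=> i _; exact: (h.2 0 i).
by split => // j i; rewrite ord1; exact: (h i).
Qed.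

(** The product sigma-algebra contains the open sets: an open set is the union of the
    balls with rational centre and radius [1 / (k + 1)] that it contains. *)
Lemma open_measurable_rV (U : set 'rV[R]_n) : open U -> measurable U.
Proof.
move=> oU.
pose q (z : 'rV[rat]_n) : 'rV[R]_n := map_mx ratr z.
pose F (z : 'rV[rat]_n * nat) : set 'rV[R]_n :=
  if `[< ball (q z.1) z.2.+1%:R^-1 `<=` U >] then ball (q z.1) z.2.+1%:R^-1 else set0.
rewrite (_ : U = \bigcup_z F z).
  apply: countable_bigcupT_measurable => // z; rewrite /F.
  by case: ifP => _ //; exact: measurable_rV_ball.
apply/seteqP; split => [x Ux|x [z _]]; last first.
  by rewrite /F; case: asboolP => // zU /zU.
have /nbhs_ballP[e /= e0 xeU] : nbhs x U by apply: open_nbhs_nbhs.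
have [k ke] : exists k : nat, k.+1%:R^-1 < e / 2.
  have e2 : 0 < e / 2 by rewrite divr_gt0.
  exists (Num.truncn (e / 2)^-1).
  rewrite invf_plt ?posrE ?ltr0n// truncnS_gt// .
have k0 : 0 < k.+1%:R^-1 :> R by rewrite invr_gt0 ltr0n.
have /choice[r hr] : forall i : 'I_n, exists r : rat, `|x 0 i - ratr r| < k.+1%:R^-1.
  move=> i; have : x 0 i - k.+1%:R^-1 < x 0 i + k.+1%:R^-1.
    by rewrite ltrD2l gtrN.
  move=> /rat_in_itvoo[r]; rewrite in_itv/= => /andP[h1 h2]; exists r.
  by rewrite distrC ltr_distl h1 h2.
exists (\row_i r i, k) => //.
have qx : ball (q (\row_i r i)) k.+1%:R^-1 x.
  by split => // j i; rewrite ord1 /q !mxE; apply: ball_sym; exact: hr.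
rewrite /F asboolT//= => y qy; apply: xeU.
apply: (@le_ball _ _ _ (k.+1%:R^-1 + k.+1%:R^-1)).
  by rewrite (splitr e) lerD// ltW.
by apply: (ball_triangle _ qy); exact: ball_sym.
Qed.

Lemma continuous_measurable_rV (f : 'rV[R]_n -> R) :
  continuous f -> measurable_fun [set: 'rV[R]_n] f.
Proof.
move=> /continuousP cf; apply: (measurability _ (RGenOpens.measurableE R)).
move=> _ [_ [a [b ->] <-]]; rewrite setTI.
by apply: open_measurable_rV; exact/cf/interval_open.
Qed.

End rV_borel.

Section box.
Variable R : realType.

(** The closed cube of points with all coordinates between [a] and [b]. *)
Definition box n (a b : R) : set 'rV[R]_n := [set x | forall i, a <= x 0 i <= b].

Lemma measurable_box n a b : measurable (@box n a b).
Proof.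
rewrite (_ : @box n a b = \bigcap_(i in [set: 'I_n]) (@rV_coord R n i @^-1` `[a, b])).
  apply: fin_bigcap_measurable => // i _; rewrite -[X in measurable X]setTI.
  by apply: measurable_rV_coord.
by apply/seteqP; split => y /= h i; [move=> _|]; have := h i; rewrite /= in_itv/=; [|apply].
Qed.

Lemma rV_cons0 n a (v : 'rV[R]_n) : rV_cons (a, v) 0 0 = a.
Proof. by have := rV_consK (a, v) => -[]. Qed.

Lemma rV_consS n a (v : 'rV[R]_n) i : rV_cons (a, v) 0 (lift 0 i) = v 0 i.
Proof.
have := rV_consK (a, v); rewrite /rV_uncons => -[_ /rowP/(_ i)].
by rewrite mxE.
Qed.

Lemma box_consE n a b t (v : 'rV[R]_n) :
  @box n.+1 a b (rV_cons (t, v)) <-> a <= t <= b /\ @box n a b v.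
Proof.
split=> [h|[h1 h2] i].
  split; first by have := h 0; rewrite rV_cons0.
  by move=> i; have := h (lift 0 i); rewrite rV_consS.
have [j ->|->] := unliftP 0 i; first by rewrite rV_consS.
by rewrite rV_cons0.
Qed.

Lemma lebesgue_rV_box n a b : a <= b ->
  lebesgue_rV R n (@box n a b) = ((b - a) ^+ n)%:E.
Proof.
move=> ab.
have L : (@lebesgue_measure R) `[a, b]%classic = (b - a)%:E.
  rewrite lebesgue_measure_itv/= lte_fin; case: ltgtP ab => // -> _.
  by rewrite subrr.
elim: n => [|n IH] /=.
  by rewrite diracE mem_set// => -[].
rewrite /lebesgue_rVS /pushforward.
rewrite (_ : _ @^-1` _ = `[a, b]%classic `*` @box n a b).
  rewrite product_measure1E//; last exact: measurable_box.
  by rewrite exprS EFinM -IH -L.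
by apply/seteqP; split => -[t v] /=; rewrite box_consE in_itv.
Qed.

Lemma integrable_box n a b C (f : 'rV[R]_n -> R) : a <= b ->
  measurable_fun setT f -> (forall x, `|f x| <= C) ->
  (forall x, ~ @box n a b x -> f x = 0) ->
  (lebesgue_rV R n).-integrable setT (EFin \o f).
Proof.
move=> ab mf fC f0.
rewrite (_ : _ \o _ = (EFin \o f) \_ (@box n a b)).
    apply: (proj1 (integrable_mkcond _ (@measurable_box n a b))).
    apply: measurable_bounded_integrable; first exact: measurable_box.
    - by have : (lebesgue_rV R n (@box n a b) < +oo)%E by rewrite lebesgue_rV_box// ltry.
    - exact: measurable_funTS.
    - exists C; split; first exact: num_real.
      by move=> M CM x _ /=; rewrite (le_trans (fC x))// ltW.
  apply/funext => x; rewrite patchE; case: ifPn => // /negP xB.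
  by rewrite /= f0// => xB'; apply: xB; rewrite inE.
Qed.

End box.

(** * Integrals of partial derivatives *)

(** A directional derivative depends only on the restriction to a line. *)
Lemma is_derive_line (R : realType) (V V' W : normedModType R) (f : V -> W)
    (f' : V' -> W) (x v : V) (x' v' : V') d :
  (forall h, f (h *: v + x) = f' (h *: v' + x')) ->
  is_derive x v f d -> is_derive x' v' f' d.
Proof.
move=> ff' [fx fd].
have fx' : f x = f' x' by have := ff' 0; rewrite !scale0r !add0r.
have E : (fun h => h^-1 *: ((f \o shift x) (h *: v) - f x)) =
         (fun h => h^-1 *: ((f' \o shift x') (h *: v') - f' x')).
  by apply/funext => h /=; rewrite ff' fx'.
split; first by move: fx; rewrite /derivable E.
by move: fd; rewrite /derive E.
Qed.

Section integral_partial.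
Variable R : realType.

Lemma continuous_rV_consl n t : continuous (fun v : 'rV[R]_n => rV_cons (t, v)).
Proof.
move=> v s /= /nbhs_ballP[e /= e0 es].
apply/nbhs_ballP; exists e => //= w [_ vw]; apply: es.
split => // i j; rewrite ord1.
have [k ->|->] := unliftP 0 j; first by rewrite !rV_consS; exact: vw.
by rewrite !rV_cons0; exact: ballxx.
Qed.

Lemma continuous_rV_consr n (v : 'rV[R]_n) : continuous (fun t : R => rV_cons (t, v)).
Proof.
move=> t s /= /nbhs_ballP[e /= e0 es].
apply/nbhs_ballP; exists e => //= w tw; apply: es.
split => // i j; rewrite ord1.
have [k ->|->] := unliftP 0 j; last by rewrite !rV_cons0.
by rewrite !rV_consS; exact: ballxx.
Qed.

Lemma rV_lineE n h (x : 'rV[R]_n) i k :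
  (h *: delta_mx 0 i + x) 0 k = h * (k == i)%:R + x 0 k.
Proof. by rewrite !mxE eqxx. Qed.

Lemma rV_consZD0 n h t (v : 'rV[R]_n) :
  rV_cons (h + t, v) = h *: delta_mx 0 0 + rV_cons (t, v).
Proof.
apply/rowP => j; rewrite rV_lineE.
have [k ->|->] := unliftP 0 j.
  by rewrite !rV_consS eq_sym (negbTE (neq_lift _ _)) mulr0 add0r.
by rewrite !rV_cons0 eqxx mulr1.
Qed.

Lemma rV_consZDS n h t (v : 'rV[R]_n) j :
  rV_cons (t, h *: delta_mx 0 j + v) =
  h *: delta_mx 0 (lift 0 j) + rV_cons (t, v).
Proof.
apply/rowP => i; rewrite rV_lineE.
have [k ->|->] := unliftP 0 i.
  by rewrite !rV_consS rV_lineE (inj_eq lift_inj).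
by rewrite !rV_cons0 (negbTE (neq_lift _ _)) mulr0 add0r.
Qed.

(** If [f] and its continuous [i]-th partial derivative [g] vanish outside a box, then [g]
    has integral [0].  Induction on the dimension: for [i = 0] the inner integral over
    the first coordinate vanishes by the fundamental theorem of calculus, and for
    [i > 0] the inner integral over the other coordinates vanishes by induction. *)
Lemma integral_partial0 n (i : 'I_n) (f g : 'rV[R]_n -> R) (a b C : R) :
  a <= b -> continuous g -> (forall x, `|g x| <= C) ->
  (forall x, ~ box a b x -> f x = 0) ->
  (forall x, ~ box a b x -> g x = 0) ->
  (forall x, is_derive x (delta_mx 0 i) f (g x)) ->
  (\int[lebesgue_rV R n]_x (g x)%:E = 0)%E.
Proof.
move=> ab; elim: n i f g => [|n IH] i f g cg gC f0 g0 dfg; first by case: i dfg.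
have mg := continuous_measurable_rV cg.
have ig := integrable_box ab mg gC g0.
pose G := (EFin \o g) \o @rV_cons R n.
have mG : measurable_fun setT G.
  apply: measurableT_comp; first exact/measurable_EFinP.
  exact: measurable_rV_cons.
have iG : (@lebesgue_measure R \x lebesgue_rV R n)%E.-integrable setT G.
  apply/integrableP; split => //.
  have /integrableP[_] := ig.
  rewrite (_ : (\int[_]_x _)%E = (\int[pushforward
    (@lebesgue_measure R \x lebesgue_rV R n)%E (@rV_cons R n)]_x `|(EFin \o g) x|)%E)//.
  rewrite ge0_integral_pushforward ?preimage_setT//.
  - exact: measurable_rV_cons.
  - by apply: measurableT_comp => //; exact/measurable_EFinP.
transitivity (\int[(@lebesgue_measure R \x lebesgue_rV R n)%E]_z G z)%E.
  transitivity (\int[pushforward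
    (@lebesgue_measure R \x lebesgue_rV R n)%E (@rV_cons R n)]_x (EFin \o g) x)%E => //.
  rewrite integral_pushforward ?preimage_setT//.
  - exact: measurable_rV_cons.
  - exact/measurable_EFinP.
have [j ij|i0] := unliftP 0 i.
- rewrite -integral12_prod_meas1//.
  rewrite integral0_eq// => t _; rewrite /fubini_F /G /=.
  apply: (IH j (fun v => f (rV_cons (t, v))) (fun v => g (rV_cons (t, v)))).
    + move=> v; apply: (@continuous_comp _ _ _ (fun v => rV_cons (t, v)) g); last exact: cg.
      exact: continuous_rV_consl.
    + by move=> x; exact: gC.
    + by move=> v nB; apply: f0 => /box_consE[].
    + by move=> v nB; apply: g0 => /box_consE[].
    + move=> v; apply: is_derive_line (dfg (rV_cons (t, v))) => h.
      by rewrite ij rV_consZDS.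
- rewrite -integral21_prod_meas1//.
  rewrite integral0_eq// => v _; rewrite /fubini_G /G /=.
  pose F t := f (rV_cons (t, v)).
  have dF (t : R) : is_derive t 1 F (g (rV_cons (t, v))).
    apply: is_derive_line (dfg (rV_cons (t, v))) => h.
    by rewrite i0 /F [h *: 1]mulr1 rV_consZD0.
  have cG : continuous (fun t => g (rV_cons (t, v))).
    move=> t; apply: (@continuous_comp _ _ _ (fun t => rV_cons (t, v)) g); last exact: cg.
    exact: continuous_rV_consr.
  have cF : continuous F.
    by move=> t; apply/differentiable_continuous/derivable1_diffP.
  (* The endpoints are moved out of the box, where F vanishes. *)
  have ab1 : a - 1 < b + 1 by lra.
  have FTC : (\int[lebesgue_measure]_(t in `[(a - 1)%R, (b + 1)%R]) (g (rV_cons (t, v)))%:E)%E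
     = ((F (b + 1))%:E - (F (a - 1))%:E)%E.
    apply: continuous_FTC2 => //.
    - exact: continuous_subspaceT.
    - split; first by move=> t _; apply: ex_derive.
      + exact/cvg_at_right_filter/cF.
      + exact/cvg_at_left_filter/cF.
    - by move=> t _; rewrite derive1E; apply: derive_val.
  transitivity (\int[lebesgue_measure]_(t in `[(a - 1)%R, (b + 1)%R]) (g (rV_cons (t, v)))%:E)%E.
    rewrite [RHS]integral_mkcond; apply: eq_integral => t _.
    rewrite patchE; case: ifPn => // /negP tab.
    rewrite g0// => /box_consE[/andP[h1 h2] _]; apply: tab.
    by rewrite inE /= in_itv/=; apply/andP; split; lra.
  rewrite FTC /F !f0 ?sube0// => /box_consE[/andP[h1 h2] _]; lra.
Qed.

End integral_partial.

(** * Divergence-free fields with continuous partial derivatives *)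

Section vanishing_outside_box.
Variables (R : realType) (n : nat).
Implicit Types g : 'rV[R]_n -> R.

Lemma compact_box (a b : R) : compact (box a b : set 'rV[R]_n).
Proof.
rewrite (_ : box a b = [set x : 'rV[R]_n | forall i, `[a, b]%classic (x ord0 i)]).
  by apply: (@rV_compact R n (fun=> `[a, b]%classic)) => i; exact: segment_compact.
by apply/seteqP; split => x /= h i; have := h i; rewrite in_itv.
Qed.

Lemma bounded_box g (a b : R) : continuous g -> (forall x, ~ box a b x -> g x = 0) ->
  exists C, forall x, `|g x| <= C.
Proof.
move=> cg g0.
have : compact (g @` box a b).
  by apply: continuous_compact; [exact: continuous_subspaceT|exact: compact_box].
move=> /compact_bounded[M [_ hM]].
exists (`|M| + 1) => x; have [xB|xB] := pselect (box a b x).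
  apply: (hM (`|M| + 1)); last by exists x.
  by rewrite (le_lt_trans (ler_norm _))// ltrDl.
by rewrite g0// normr0 addr_ge0.
Qed.

Lemma integrable_continuous_box g (a b : R) : a <= b -> continuous g ->
  (forall x, ~ box a b x -> g x = 0) ->
  (lebesgue_rV R n).-integrable setT (EFin \o g).
Proof.
move=> ab cg g0; have [C gC] := bounded_box cg g0.
exact: integrable_box ab (continuous_measurable_rV cg) gC g0.
Qed.

(** The conclusion holds near [x] rather than at [x], so that derivatives of [eta] also
    vanish outside the box. *)
Lemma compact_support_box (eta : 'rV[R]_n -> R) : compact_support eta ->
  exists2 b : R, 0 <= b & forall x, ~ box (- b) b x -> \near x, eta x = 0.
Proof.
move=> ceta; have [M [_ hM]] := compact_bounded ceta.
exists (`|M| + 1) => [|x xB]; first by rewrite addr_ge0.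
have oC : open (~` closure [set x | eta x != 0]).
  by apply: closed_openC; exact: closed_closure.
have : nbhs x (~` closure [set x | eta x != 0]).
  apply: open_nbhs_nbhs; split => // cx; apply: xB => i.
  have := hM (`|M| + 1); rewrite (le_lt_trans (ler_norm _)) ?ltrDl// => /(_ isT x cx) /= h.
  rewrite -ler_norml; apply: le_trans h.
  rewrite [in leRHS]/Num.Def.normr/= mx_normrE.
  exact: (le_bigmax _ (fun ij => `|x ij.1 ij.2|) (ord0, i)).
apply: filterS => y yC; apply/eqP; apply: contra_notT yC => h.
exact: subset_closure.
Qed.

End vanishing_outside_box.

Section div_free_C1.
Variables (R : realType) (n : nat).

(** The field [v] itself need not have compact support: with
    [\sum_i dv i = 0], the integrand [v . grad eta] equals
    [\sum_i D_i (v_i * eta)], and [eta] has compact support. *)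
Lemma div_free_C1 (v : 'rV[R]_n -> 'rV[R]_n) (dv : 'I_n -> 'rV[R]_n -> R) :
  (forall i, continuous (fun x => v x 0 i)) ->
  (forall i, continuous (dv i)) ->
  (forall i x, is_derive x (delta_mx 0 i) (fun y => v y 0 i) (dv i x)) ->
  (forall x, \sum_i dv i x = 0) -> div_free v.
Proof.
move=> cv cdv Dv dv0 eta seta ceta.
have [b b0 eta0] := compact_support_box ceta.
have bb : - b <= b by rewrite (le_trans _ b0)// oppr_le0.
have ceta1 : continuous eta.
  by move=> x; apply: differentiable_continuous; exact: (seta [::]).
have cdeta w : continuous ('D_w eta).
  by move=> x; apply: differentiable_continuous; exact: (seta [:: w]).
pose g i x := v x 0 i * 'D_(delta_mx 0 i) eta x + eta x * dv i x.
have cg i : continuous (g i).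
  move=> x; apply: (@continuousD _ _ _ (fun x => v x 0 i * 'D_(delta_mx 0 i) eta x)
    (fun x => eta x * dv i x)).
  - by apply: continuousM; [exact: cv|exact: cdeta].
  - by apply: continuousM; [exact: ceta1|exact: cdv].
have g0 i x : ~ box (- b) b x -> g i x = 0.
  move=> /eta0 near0; rewrite /g (nbhs_singleton near0) mul0r addr0.
  rewrite (@near_eq_derive _ _ _ _ (cst 0))// ?derive_cst ?mulr0//.
have Ig i : (\int[lebesgue_rV R n]_x (g i x)%:E = 0)%E.
  have [C gC] := bounded_box (cg i) (@g0 i).
  apply: (integral_partial0 (i := i) (f := fun x => v x 0 i * eta x) bb (cg i) gC).
  - by move=> x /eta0 near0; rewrite (nbhs_singleton near0) mulr0.
  - exact: g0.
  - move=> x.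
    have Deta : is_derive x (delta_mx 0 i) eta ('D_(delta_mx 0 i) eta x).
      by apply: derivableP; apply: diff_derivable; exact: (seta [::]).
    exact: (is_deriveM (Dv i x) Deta).
rewrite /Rintegral (eq_integral (fun x => \sum_(i < n) (EFin \o g i) x)%E).
  rewrite integral_sum//; first by rewrite big1// => i _; rewrite /= Ig.
  by move=> i; exact: integrable_continuous_box bb (cg i) (@g0 i).
move=> x _; rewrite sumEFin; congr EFin; rewrite /g big_split/=.
by rewrite -mulr_sumr dv0 mulr0 addr0.
Qed.

End div_free_C1.

(** * Planar vortices *)

Section vortex.
Variables (R : realType) (n : nat) (i0 i1 : 'I_n).
Hypothesis i01 : i0 != i1.
Variables (kappa L : R).
Hypotheses (kappa0 : 0 <= kappa) (L0 : 0 < L).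
Implicit Types x v : 'rV[R]_n.

(** The coordinates of the infinitesimal rotation [- x_i1 e_i0 + x_i0 e_i1]. *)
Definition rot x (i : 'I_n) : R := x 0 i0 * (i == i1)%:R - x 0 i1 * (i == i0)%:R.

Definition cutoff_arg x : R := 1 - L ^- 2 * dot x x.

(** [kappa] times the rotation field, cut off at the sphere of radius [L].  It is divergence-free
    because the cutoff is radial and the rotation is tangent to spheres. *)
Definition vortex x : 'rV[R]_n := \row_i (kappa * flat 1 (cutoff_arg x) * rot x i).

(** The derivative in the direction [v] of the [i]-th coordinate of [vortex]. *)
Definition dvortex i v x : R :=
  kappa * (flat (dflat 1) (cutoff_arg x) * (- (L ^- 2 * (2 * dot x v))) * rot x i +
           flat 1 (cutoff_arg x) * rot v i).

Lemma vortexE x i : vortex x 0 i = kappa * flat 1 (cutoff_arg x) * rot x i.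
Proof. by rewrite mxE. Qed.

Lemma elem_vortex i : elementary (fun x => vortex x 0 i).
Proof.
rewrite (_ : (fun _ => _) = cst kappa \* (flat 1 \o (cst 1 \+ (\- (cst (L ^- 2) \*
    (fun x => \sum_k x 0 k * x 0 k))))) \* ((fun x => x 0 i0) \* cst (i == i1)%:R \+
    (\- ((fun x => x 0 i1) \* cst (i == i0)%:R)))); last first.
  by apply/funext => x; rewrite vortexE.
apply: elem_mul.
  apply: elem_mul; first exact: elem_cst.
  apply/elem_flat/elem_add; first exact: elem_cst.
  apply/elem_opp/elem_mul; first exact: elem_cst.
  apply: (@elem_sum _ _ n (fun k x => x 0 k * x 0 k)) => k.
  by apply: elem_mul; exact: elem_coord.
apply: elem_add; first by apply: elem_mul; [exact: elem_coord|exact: elem_cst].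
by apply/elem_opp/elem_mul; [exact: elem_coord|exact: elem_cst].
Qed.

Lemma is_derive_coord x v k : is_derive x v (fun y : 'rV[R]_n => y 0 k) (v 0 k).
Proof.
have dfid : derivable (id : 'rV[R]_n -> 'rV[R]_n) x v by exact: derivable_id.
split; first exact: ((derivable_mxP _ _ _).1 dfid 0 k).
have := derive_mx dfid; rewrite derive_id => /matrixP/(_ 0 k).
by rewrite [RHS]mxE => ->.
Qed.

Lemma is_derive_dot x v : is_derive x v (fun y : 'rV[R]_n => dot y y) (2 * dot x v).
Proof.
have H k := is_deriveM (is_derive_coord x v k) (is_derive_coord x v k).
have := is_derive_sum H; move/is_derive_eq.
rewrite fct_sumE; apply.
by rewrite /dot mulr_sumr; apply: eq_bigr => k _; rewrite /GRing.scale/=; ring.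
Qed.

Lemma is_derive_vortex x v i : is_derive x v (fun y => vortex y 0 i) (dvortex i v x).
Proof.
have Dq : is_derive x v cutoff_arg (- (L ^- 2 * (2 * dot x v))).
  have := is_deriveB (is_derive_cst (1 : R) x v) (is_deriveZ (L ^- 2) (is_derive_dot x v)).
  by move/is_derive_eq; apply; rewrite sub0r.
have Df := is_derive_flat_comp 1 Dq.
have Dw : is_derive x v (fun y => rot y i) (rot v i).
  have := is_deriveB (is_deriveZ (i == i1)%:R (is_derive_coord x v i0))
    (is_deriveZ (i == i0)%:R (is_derive_coord x v i1)).
  rewrite (_ : (_ \*: _ - _ \*: _) = fun y => rot y i); last first.
    by apply/funext => y; rewrite /rot !fctE /= /GRing.scale/=; ring.
  by move/is_derive_eq; apply; rewrite /rot /GRing.scale/=; ring.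
have := is_deriveM (is_deriveZ kappa Df) Dw.
rewrite (_ : _ * _ = fun y => vortex y 0 i); last first.
  by apply/funext => y; rewrite vortexE.
move/is_derive_eq; apply.
by rewrite /dvortex !fctE /= /GRing.scale/=; ring.
Qed.

Lemma dot_delta_mx x k : dot x (delta_mx 0 k) = x 0 k.
Proof.
rewrite /dot (bigD1 k)//= mxE !eqxx mulr1 big1 ?addr0// => j jk.
by rewrite mxE (negbTE jk) andbF mulr0.
Qed.

Lemma vortex_div0 x : \sum_i dvortex i (delta_mx 0 i) x = 0.
Proof.
have rotd k : rot (delta_mx 0 k) k = 0.
  rewrite /rot !mxE !eqxx /=.
  case: eqVneq => [<-|]; last first.
    by rewrite mul0r sub0r; case: eqVneq => [|_]; rewrite ?mul0r ?mulr0 ?oppr0//.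
  by rewrite (negbTE i01) mulr0 sub0r mulr1 eq_sym (negbTE i01) oppr0.
transitivity (\sum_i (- 2 * kappa * L ^- 2 * flat (dflat 1) (cutoff_arg x)) *
    (x 0 i * rot x i)).
  apply: eq_bigr => i _; rewrite /dvortex dot_delta_mx rotd; ring.
rewrite -mulr_sumr [X in _ * X](_ : _ = 0) ?mulr0//.
rewrite /rot; under eq_bigr do rewrite mulrBr.
rewrite sumrB (bigD1 i1)//= big1 ?addr0; last first.
  by move=> j /negbTE ->; rewrite !mulr0.
rewrite (bigD1 i0)//= big1 ?addr0; last first.
  by move=> j /negbTE ->; rewrite !mulr0.
by rewrite !eqxx; ring.
Qed.

Lemma normr_coord_le x k : 0 < cutoff_arg x -> `|x 0 k| <= L.
Proof.
rewrite /cutoff_arg subr_gt0 mulrC ltr_pdivrMr ?exprn_gt0// mul1r => h.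
rewrite -(ler_pXn2r (ltn0Sn 1)) ?nnegrE ?normr_ge0 ?(ltW L0)//.
rewrite real_normK ?num_real// (le_trans _ (ltW h))//.
rewrite /dot (bigD1 k)//= -expr2 lerDl sumr_ge0// => j _.
by rewrite -expr2 sqr_ge0.
Qed.

Lemma normr_rot_le x i C : (forall k, `|x 0 k| <= C) -> `|rot x i| <= C.
Proof.
move=> xC; rewrite /rot.
have C0 : 0 <= C := le_trans (normr_ge0 _) (xC i0).
case: (eqVneq i i1) => [->|_]; first by rewrite eq_sym (negbTE i01) mulr1 mulr0 subr0.
case: (eqVneq i i0) => _; first by rewrite mulr0 mulr1 sub0r normrN.
by rewrite !mulr0 subr0 normr0.
Qed.

(** The gradient of the cutoff is [O(1 / L)] where the rotation field is [O(L)]. *)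
Lemma normr_dvortex_le x i j : `|dvortex i (delta_mx 0 j) x| <= 5 * kappa.
Proof.
have [q0|q0] := leP (cutoff_arg x) 0.
  by rewrite /dvortex !flat_le0// !mul0r addr0 mulr0 normr0 mulr_ge0.
rewrite /dvortex dot_delta_mx normrM (ger0_norm kappa0) mulrC ler_wpM2r//.
have h1 : `|rot (delta_mx 0 j) i| <= 1.
  by apply: normr_rot_le => k; rewrite mxE; case: (_ && _); rewrite ?normr0 ?normr1.
have h2 : `|rot x i| <= L by apply: normr_rot_le => k; exact: normr_coord_le.
have h3 := normr_coord_le j q0.
have h4 := normr_dflat1 (cutoff_arg x).
have h5 : `|flat 1 (cutoff_arg x)| <= 1 by rewrite ger0_norm ?flat1_ge0 ?flat1_le1.
rewrite (le_trans (ler_normD _ _))// (_ : 5 = 2 * 2 + 1); last by ring.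
rewrite lerD//; last by rewrite normrM -[leRHS]mulr1 ler_pM.
rewrite -mulrA normrM ler_pM//.
have Lp : 0 < L ^+ 2 by rewrite exprn_gt0.
rewrite normrM normrN !normrM (@ger0_norm _ (L ^- 2)) ?invr_ge0 ?(ltW Lp)//.
rewrite (@ger0_norm _ 2)// -mulrA.
rewrite ler_pdivrMl// -mulrA mulrC ler_wpM2r//.
by rewrite expr2 ler_pM.
Qed.

Lemma vortex_out x : ~ box (- L) L x -> vortex x = 0.
Proof.
move=> xB; apply/rowP => i; rewrite vortexE mxE.
have [q0|q0] := leP (cutoff_arg x) 0; first by rewrite flat_le0// mulr0 mul0r.
by exfalso; apply: xB => k; rewrite -ler_norml normr_coord_le.
Qed.

Lemma dot_vortex x : dot (vortex x) (vortex x) =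
  kappa ^+ 2 * (flat 1 (cutoff_arg x) ^+ 2 * (x 0 i0 ^+ 2 + x 0 i1 ^+ 2)).
Proof.
have i10 : (i1 == i0) = false by rewrite eq_sym (negbTE i01).
rewrite /dot (bigD1 i0)//= (bigD1 i1) ?i10//= big1 ?addr0.
  rewrite !vortexE /rot !eqxx i10 (negbTE i01) !mulr0 !mulr1; ring.
by move=> j /andP[/negbTE j0 /negbTE j1]; rewrite !vortexE /rot j0 j1 !mulr0; ring.
Qed.

End vortex.

(** * Vortices of unit energy and small gradient *)

Section normalized_vortex.
Variables (R : realType) (n : nat) (i0 i1 : 'I_n).
Hypothesis i01 : i0 != i1.

Lemma continuous_vortex kappa L i :
  continuous (fun x : 'rV[R]_n => vortex i0 i1 kappa L x 0 i).
Proof.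
by move=> x; apply: differentiable_continuous; apply: differentiable_elem; exact: elem_vortex.
Qed.

Lemma continuous_dot_vortex kappa L :
  continuous (fun x : 'rV[R]_n => dot (vortex i0 i1 kappa L x) (vortex i0 i1 kappa L x)).
Proof.
move=> x; apply: differentiable_continuous; apply: differentiable_elem.
apply: (@elem_sum _ _ n (fun i y => vortex i0 i1 kappa L y 0 i * vortex i0 i1 kappa L y 0 i)) => i.
by apply: elem_mul; exact: elem_vortex.
Qed.

Lemma integrable_dot_vortex kappa L : 0 < L ->
  (lebesgue_rV R n).-integrable setT
    (EFin \o (fun x => dot (vortex i0 i1 kappa L x) (vortex i0 i1 kappa L x))).
Proof.
move=> L0; apply: (integrable_continuous_box (a := - L) (b := L)).
- by rewrite (le_trans _ (ltW L0))// oppr_le0 ltW.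
- exact: continuous_dot_vortex.
- move=> x xB; rewrite vortex_out// /dot big1// => i _; by rewrite mxE mul0r.
Qed.

(** On the box of points with coordinates between [1] and [1 + s] the rotation field
    has norm at least [1], and the radius [2 * n * (1 + s)] makes the argument of the cutoff at
    least [1 / 2]; the measure of the box is [s ^ n >= s]. *)
Lemma le_integral_dot_vortex s : 1 <= s ->
  ((flat 1 (2^-1 : R) ^+ 2 * s)%:E <= \int[lebesgue_rV R n]_x
    (dot (vortex i0 i1 1 (2 * n%:R * (1 + s)) x) (vortex i0 i1 1 (2 * n%:R * (1 + s)) x))%:E)%E.
Proof.
move=> s1; set L := 2 * _ * _.
have n0 : (0 < n)%N by exact: leq_ltn_trans (ltn_ord i0).
have n1 : 1 <= n%:R :> R by rewrite ler1n.
have s0 : 0 < s by exact: lt_le_trans s1.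
have s10 : 0 < 1 + s by rewrite addr_gt0.
have L0 : 0 < L by rewrite /L !mulr_gt0// ltr0n.
set f := fun x => _.
have f0 x : (0 <= f x)%E by rewrite lee_fin dotxx_ge0.
have mf : measurable_fun setT f.
  by apply/measurable_EFinP; exact: continuous_measurable_rV (@continuous_dot_vortex 1 L).
apply: (@le_trans _ _ (\int[lebesgue_rV R n]_(x in box 1 (1 + s)) f x)%E); last first.
  by apply: ge0_subset_integral => //; exact: measurable_box.
apply: (@le_trans _ _ (\int[lebesgue_rV R n]_(x in box 1 (1 + s)) (flat 1 (2^-1 : R) ^+ 2)%:E)%E).
  rewrite integral_cst; last exact: measurable_box.
  rewrite -[X in (_ <= _ * X)%E]/(lebesgue_rV R n (box 1 (1 + s))).
  rewrite lebesgue_rV_box ?lerDl ?(ltW s0)// addrAC subrr add0r.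
  rewrite -EFinM lee_fin ler_wpM2l ?sqr_ge0//.
  by rewrite -[leLHS]expr1 ler_weXn2l.
apply: ge0_le_integral => //.
- exact: measurable_box.
- by move=> x _; rewrite lee_fin sqr_ge0.
- exact: measurable_funTS.
move=> x /= xB; rewrite lee_fin dot_vortex// expr1n mul1r.
have xs k : 0 <= x 0 k ^+ 2 <= (1 + s) ^+ 2.
  have /andP[h1 h2] := xB k.
  rewrite sqr_ge0/= ler_pXn2r// nnegrE ?(ltW s10)//.
  by rewrite (le_trans _ h1).
have x1 k : 1 <= x 0 k ^+ 2.
  by have /andP[h1 _] := xB k; rewrite expr_ge1// (le_trans _ h1).
rewrite -[leLHS]mulr1 ler_pM ?sqr_ge0//; last first.
  by rewrite (le_trans (x1 i0))// lerDl sqr_ge0.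
rewrite ler_pXn2r ?nnegrE ?flat1_ge0//; apply: flat1_nd.
rewrite /cutoff_arg lerBrDl -lerBrDr mulrC ler_pdivrMr ?exprn_gt0//.
have dx : dot x x <= n%:R * (1 + s) ^+ 2.
  have -> : n%:R * (1 + s) ^+ 2 = \sum_(k < n) (1 + s) ^+ 2.
    by rewrite sumr_const card_ord mulr_natl.
  by apply: ler_sum => k _; rewrite -expr2; have /andP[] := xs k.
rewrite (le_trans dx)// /L !exprMn.
have : 0 <= (1 + s) ^+ 2 by rewrite sqr_ge0.
set y := (1 + s) ^+ 2 => y0.
have ny : 0 <= n%:R * y by rewrite mulr_ge0.
have n1y : 0 <= (n%:R - 1) * (n%:R * y) by rewrite mulr_ge0// subr_ge0.
have -> : (1 - 2^-1) * (2 ^+ 2 * n%:R ^+ 2 * y) = 2 * ((n%:R - 1) * (n%:R * y)) + 2 * (n%:R * y).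
  by field.
lra.
Qed.

Lemma exists_normalized_vortex eps : 0 < eps ->
  exists kappa L : R, [/\ 0 <= kappa, 0 < L, 5 * kappa <= eps &
    (\int[lebesgue_rV R n]_x
      (dot (vortex i0 i1 kappa L x) (vortex i0 i1 kappa L x))%:E = 1)%E].
Proof.
move=> eps0; pose c : R := flat 1 (2^-1 : R) ^+ 2.
have c0 : 0 < c by rewrite exprn_gt0// flat1_gt0 ?invr_gt0.
pose s := Num.max 1 ((5 / eps) ^+ 2 / c).
have s1 : 1 <= s by rewrite le_max lexx.
have n0 : (0 < n)%N by exact: leq_ltn_trans (ltn_ord i0).
pose L := 2 * n%:R * (1 + s).
have L0 : 0 < L by rewrite /L !mulr_gt0 ?ltr0n// addr_gt0// (lt_le_trans _ s1).
have := le_integral_dot_vortex s1; rewrite -/c -/L.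
have := integrable_fin_num measurableT (integrable_dot_vortex 1 L0).
rewrite /=; set I := (\int[_]_x _)%E => Ifin cI.
pose K := fine I.
have IK : I = K%:E by rewrite fineK.
have K5 : (5 / eps) ^+ 2 <= K.
  move: cI; rewrite IK lee_fin; apply: le_trans.
  by rewrite (mulrC c) -ler_pdivrMr// le_max lexx orbT.
have K0 : 0 < K by apply: lt_le_trans K5; rewrite exprn_gt0// divr_gt0.
have sK0 : 0 < Num.sqrt K by rewrite sqrtr_gt0.
exists (Num.sqrt K)^-1, L; split => //.
  rewrite ler_pdivrMr// mulrC -ler_pdivrMr//.
  rewrite -(ler_pXn2r (ltn0Sn 1)) ?nnegrE ?(ltW sK0) ?divr_ge0 ?(ltW eps0)//.
  by rewrite sqr_sqrtr// ltW.
transitivity ((K^-1)%:E * I)%E; last by rewrite IK -EFinM mulVf// gt_eqF.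
rewrite -integralZl//; last exact: integrable_dot_vortex.
apply: eq_integral => x _; rewrite -EFinM; congr EFin.
by rewrite !dot_vortex// expr1n mul1r exprVn sqr_sqrtr// ltW.
Qed.

End normalized_vortex.

(** * The test fields *)

Section time_cutoff.
Variables (R : realType) (tau : R).
Hypothesis tau0 : 0 < tau.
Implicit Types t : R.

(** A bump function equal to [exp (-1)] at [0] and vanishing for [|t| >= tau]. *)
Definition time_cutoff t : R := flat 1 (1 - tau ^- 2 * t ^+ 2).

(** The derivative of [time_cutoff]. *)
Definition dtime_cutoff t : R :=
  flat (dflat 1) (1 - tau ^- 2 * t ^+ 2) * (- (tau ^- 2 * (2 * t))).

Lemma elem_time_cutoff : elementary time_cutoff.
Proof.
rewrite (_ : time_cutoff = flat 1 \o (cst 1 \+ (\- (cst (tau ^- 2) \* (id \* id))))).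
  apply/elem_flat/elem_add; first exact: elem_cst.
  by apply/elem_opp/elem_mul; [exact: elem_cst|apply: elem_mul; exact: elem_id].
by apply/funext => t; rewrite /time_cutoff /= expr2.
Qed.

Lemma is_derive_time_cutoff t : is_derive t 1 time_cutoff (dtime_cutoff t).
Proof.
have Dq : is_derive t 1 (fun s : R => 1 - tau ^- 2 * s ^+ 2) (- (tau ^- 2 * (2 * t))).
  have := is_deriveB (is_derive_cst (1 : R) t 1)
    (is_deriveZ (tau ^- 2) (is_deriveX 2 (is_derive_id t (1 : R)))).
  rewrite (_ : (_ - _) = fun s : R => 1 - tau ^- 2 * s ^+ 2); last first.
    by apply/funext => s; rewrite !fctE.
  by move/is_derive_eq; apply; rewrite sub0r /GRing.scale/= expr1; ring.
exact: is_derive_flat_comp.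
Qed.

Lemma time_cutoff_ge0 t : 0 <= time_cutoff t. Proof. exact: flat1_ge0. Qed.

Lemma time_cutoff_le1 t : time_cutoff t <= 1. Proof. exact: flat1_le1. Qed.

Lemma time_cutoff_arg_le0 t : tau <= `|t| -> 1 - tau ^- 2 * t ^+ 2 <= 0.
Proof.
move=> tt; rewrite subr_le0 mulrC ler_pdivlMr ?exprn_gt0// mul1r.
by rewrite -[leRHS]real_normK ?num_real// ler_pXn2r ?nnegrE ?(ltW tau0).
Qed.

Lemma time_cutoff_out t : tau <= `|t| -> time_cutoff t = 0.
Proof. by move=> tt; rewrite /time_cutoff flat_le0// time_cutoff_arg_le0. Qed.

Lemma dtime_cutoff_out t : tau <= `|t| -> dtime_cutoff t = 0.
Proof. by move=> tt; rewrite /dtime_cutoff flat_le0 ?mul0r// time_cutoff_arg_le0. Qed.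

Lemma normr_dtime_cutoff t : `|dtime_cutoff t| <= 4 / tau.
Proof.
have [tt|/ltW tt] := leP tau `|t|.
  by rewrite dtime_cutoff_out// normr0 divr_ge0// ltW.
rewrite /dtime_cutoff normrM (_ : 4 / tau = 2 * (2 / tau)); last by field; rewrite gt_eqF.
rewrite ler_pM ?normr_dflat1// normrN !normrM (@ger0_norm _ 2)//.
rewrite gtr0_norm ?invr_gt0 ?exprn_gt0//.
apply: (@le_trans _ _ (tau ^- 2 * (2 * tau))).
  by rewrite !ler_wpM2l// invr_ge0 exprn_ge0// ltW.
by rewrite le_eqVlt; apply/orP; left; apply/eqP; field; rewrite gt_eqF.
Qed.

End time_cutoff.

Section test_field.
Variables (R : realType) (n : nat) (i0 i1 : 'I_n).
Hypothesis i01 : i0 != i1.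
Variables (kappa L tau : R).
Hypotheses (kappa0 : 0 <= kappa) (L0 : 0 < L) (tau0 : 0 < tau).

(** The space-time test field with separated variables. *)
Definition test_field (z : 'rV[R]_n * R) : 'rV[R]_n :=
  time_cutoff tau z.2 *: vortex i0 i1 kappa L z.1.

Lemma test_fieldE z i :
  test_field z 0 i = time_cutoff tau z.2 * vortex i0 i1 kappa L z.1 0 i.
Proof. by rewrite [LHS]mxE. Qed.

Lemma elem_test_field i : elementary (fun z => test_field z 0 i).
Proof.
rewrite (_ : (fun _ => _) = (time_cutoff tau \o snd) \*
    ((fun x => vortex i0 i1 kappa L x 0 i) \o fst)); last first.
  by apply/funext => z; rewrite test_fieldE.
apply: elem_mul.
  apply: elem_precomp; last exact: elem_time_cutoff.
  by move=> z; exact: cvg_snd.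
apply: elem_precomp; last exact: elem_vortex.
by move=> z; exact: cvg_fst.
Qed.

Lemma smooth_test_field : smooth test_field.
Proof. exact: smooth_elem_rV elem_test_field. Qed.

Lemma compact_support_test_field : compact_support test_field.
Proof.
have cK : compact ((box (- L) L : set 'rV[R]_n) `*` `[- tau, tau]%classic).
  by apply: compact_setX; [exact: compact_box|exact: segment_compact].
apply: (subclosed_compact _ cK); first exact: closed_closure.
have /closure_id clK := compact_closed (@norm_hausdorff _ _) cK.
rewrite [X in _ `<=` X]clK; apply: closure_subset => -[x t] /= h; split => /=.
  by apply: contrapT => xB; move/eqP: h; apply; rewrite /test_field vortex_out// scaler0.
rewrite in_itv/= -ler_norml leNgt; apply/negP => /ltW tt.
by move/eqP: h; apply; rewrite /test_field time_cutoff_out// scale0r.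
Qed.

Lemma partial_t_test_field x t :
  partial_t test_field (x, t) = dtime_cutoff tau t *: vortex i0 i1 kappa L x.
Proof.
apply/rowP => i; rewrite /partial_t derive_mx; last first.
  by apply: diff_derivable; exact: (smooth_test_field [::]).
rewrite mxE [RHS]mxE; apply: derive_val.
have D := is_deriveM (is_derive_time_cutoff tau t)
  (is_derive_cst (vortex i0 i1 kappa L x 0 i) t 1).
have {}D : is_derive t 1 (fun s => time_cutoff tau s * vortex i0 i1 kappa L x 0 i)
    (dtime_cutoff tau t * vortex i0 i1 kappa L x 0 i).
  by apply: (is_derive_eq D); rewrite scaler0 add0r /cst /GRing.scale/= mulrC.
apply: is_derive_line D => h /=.
by rewrite test_fieldE /= scaler0 add0r.
Qed.

Lemma partial_x_test_field j x t i : partial_x j test_field (x, t) 0 i =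
  time_cutoff tau t * dvortex i0 i1 kappa L i (delta_mx 0 j) x.
Proof.
rewrite /partial_x derive_mx; last first.
  by apply: diff_derivable; exact: (smooth_test_field [::]).
rewrite mxE; apply: derive_val.
have D := is_deriveZ (time_cutoff tau t)
  (is_derive_vortex i0 i1 kappa L x (delta_mx 0 j) i).
apply: is_derive_line D => h /=.
by rewrite test_fieldE /= scaler0 add0r.
Qed.

Lemma div_x_test_field x t : div_x test_field (x, t) = 0.
Proof.
rewrite /div_x; under eq_bigr do rewrite partial_x_test_field.
by rewrite -mulr_sumr vortex_div0// mulr0.
Qed.

Lemma div_free_vortex : div_free (vortex i0 i1 kappa L).
Proof.
apply: (@div_free_C1 _ _ _ (fun i => dvortex i0 i1 kappa L i (delta_mx 0 i))).
- by move=> i; exact: continuous_vortex.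
- move=> i x; apply: differentiable_continuous; apply: differentiable_elem.
  rewrite (_ : dvortex _ _ _ _ _ _ =
      'D_(delta_mx 0 i) (fun x => vortex i0 i1 kappa L x 0 i)).
    exact/elem_derive/elem_vortex.
  by apply/funext => y; apply/esym/derive_val/is_derive_vortex.
- by move=> i x; exact: is_derive_vortex.
- exact: vortex_div0.
Qed.

Lemma measurable_vortex : measurable_fun setT (vortex i0 i1 kappa L).
Proof.
apply: measurable_fun_rV => i.
exact: continuous_measurable_rV (@continuous_vortex _ _ i0 i1 kappa L i).
Qed.

End test_field.

(** * Energy and the L^2 pairing *)

Section energy.
Variables (R : realType) (n : nat).
Implicit Types (a b : 'rV[R]_n) (v w : 'rV[R]_n -> 'rV[R]_n).

Lemma measurable_dot d (T : measurableType d) (f g : T -> 'rV[R]_n) :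
  measurable_fun setT f -> measurable_fun setT g ->
  measurable_fun setT (fun x => dot (f x) (g x)).
Proof.
move=> mf mg; apply: measurable_sum => i; apply: measurable_funM.
- exact: measurableT_comp (@measurable_rV_coord R n i) mf.
- exact: measurableT_comp (@measurable_rV_coord R n i) mg.
Qed.

Lemma dotNl a b : dot (- a) b = - dot a b.
Proof. by rewrite /dot -sumrN; apply: eq_bigr => i _; rewrite mxE mulNr. Qed.

Lemma dotDl a b c : dot (a + b) c = dot a c + dot b c.
Proof. by rewrite /dot -big_split; apply: eq_bigr => i _; rewrite mxE mulrDl. Qed.

Lemma dotZl k a b : dot (k *: a) b = k * dot a b.
Proof. by rewrite /dot mulr_sumr; apply: eq_bigr => i _; rewrite mxE mulrA. Qed.

Lemma dotZr k a b : dot a (k *: b) = k * dot a b.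
Proof. by rewrite /dot mulr_sumr; apply: eq_bigr => i _; rewrite mxE mulrCA. Qed.

Lemma normr_dot_le a b : `|dot a b| <= enorm a * enorm b.
Proof. by rewrite ler_norml dot_le lerNl -dotNl -(enormN a) dot_le. Qed.

(** Young's inequality with a weight; with the weight left free it plays the part
    of the Cauchy-Schwarz inequality. *)
Lemma dot_young t a b : 0 < t ->
  `|dot a b| <= t / 2 * dot b b + (2 * t)^-1 * dot a a.
Proof.
move=> t0; apply: (le_trans (normr_dot_le a b)).
rewrite -!sqr_enorm; set x := enorm a; set y := enorm b.
rewrite -subr_ge0 [leRHS](_ : _ = (t * y - x) ^+ 2 / (2 * t)).
  by rewrite divr_ge0 ?sqr_ge0// mulr_ge0// ltW.
by field; rewrite gt_eqF.
Qed.

Lemma sqr_coord_le_dot a i : a 0 i ^+ 2 <= dot a a.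
Proof.
rewrite /dot (bigD1 i)//= -expr2 lerDl sumr_ge0// => j _.
by rewrite -expr2 sqr_ge0.
Qed.

Lemma normr_coord_coord_le a i j : `|a 0 i * a 0 j| <= dot a a.
Proof.
have hi := sqr_coord_le_dot a i; have hj := sqr_coord_le_dot a j.
have h1 := sqr_ge0 (a 0 i - a 0 j); have h2 := sqr_ge0 (a 0 i + a 0 j).
rewrite ler_norml; apply/andP; split; nra.
Qed.

Lemma normr_quadratic_le a (D : 'I_n -> 'I_n -> R) C : (forall i j, `|D i j| <= C) ->
  `|\sum_i \sum_j a 0 i * a 0 j * D i j| <= n%:R ^+ 2 * C * dot a a.
Proof.
move=> DC; apply: (@le_trans _ _ (\sum_(i < n) \sum_(j < n) dot a a * C)).
  rewrite (le_trans (ler_norm_sum _ _ _))// ler_sum// => i _.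
  rewrite (le_trans (ler_norm_sum _ _ _))// ler_sum// => j _.
  by rewrite normrM ler_pM// normr_coord_coord_le.
rewrite !sumr_const !card_ord -[leLHS]mulr_natl -[X in _ * X]mulr_natl.
by rewrite mulrA -expr2 -mulrA (mulrC (dot _ _)).
Qed.

(** The square of the L^2 norm, as an extended real. *)
Definition energy v : \bar R := (\int[lebesgue_rV R n]_x (dot (v x) (v x))%:E)%E.

Lemma energy_ge0 v : (0 <= energy v)%E.
Proof. by apply: integral_ge0 => x _; rewrite lee_fin dotxx_ge0. Qed.

Lemma energyE v : energy v = (L2norm v `^ 2)%E.
Proof.
rewrite /L2norm powR_Lnorm//; apply: eq_integral => x _ /=.
by rewrite ger0_norm ?enorm_ge0// powR_mulrn ?enorm_ge0// sqr_enorm.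
Qed.

Lemma energy_lty v : (L2norm v < +oo)%E -> (energy v < +oo)%E.
Proof. by rewrite energyE => /poweR_lty; apply. Qed.

Lemma ge0_integral_dot v w t : measurable_fun setT v -> measurable_fun setT w ->
  0 < t -> (\int[lebesgue_rV R n]_x `|(dot (v x) (w x))%:E| <=
   (t / 2)%:E * energy w + ((2 * t)^-1)%:E * energy v)%E.
Proof.
move=> mv mw t0.
have mvv : measurable_fun setT (fun x => (dot (v x) (v x))%:E).
  by apply/measurable_EFinP; exact: measurable_dot.
have mww : measurable_fun setT (fun x => (dot (w x) (w x))%:E).
  by apply/measurable_EFinP; exact: measurable_dot.
have p1 : 0 <= t / 2 by rewrite divr_ge0// ltW.
have p2 : 0 <= (2 * t)^-1 by rewrite invr_ge0 mulr_ge0// ltW.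
rewrite /energy -!ge0_integralZl_EFin//; try by move=> x _; rewrite lee_fin dotxx_ge0.
rewrite -ge0_integralD//; last 4 first.
- by move=> x _; rewrite -EFinM lee_fin mulr_ge0// dotxx_ge0.
- exact: measurable_funeM.
- by move=> x _; rewrite -EFinM lee_fin mulr_ge0// dotxx_ge0.
- exact: measurable_funeM.
apply: ge0_le_integral => //.
- by apply: measurableT_comp => //; apply/measurable_EFinP; exact: measurable_dot.
- by apply: emeasurable_funD; exact: measurable_funeM.
- by move=> x _; rewrite -!EFinM -EFinD lee_fin dot_young.
Qed.

Lemma integrable_dot v w : measurable_fun setT v -> measurable_fun setT w ->
  (energy v < +oo)%E -> (energy w < +oo)%E ->
  (lebesgue_rV R n).-integrable setT (EFin \o (fun x => dot (v x) (w x))).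
Proof.
move=> mv mw vy wy; apply/integrableP; split.
  by apply/measurable_EFinP; exact: measurable_dot.
apply: le_lt_trans (ge0_integral_dot mv mw ltr01) _.
by rewrite lte_add_pinfty// lte_mul_pinfty.
Qed.

End energy.

(** * Integrals in time *)

Section interpolation.
Variable R : realType.

(** Either [y <= s], or [y ^ 2 = y ^ (2 - p) * y ^ p] with [y ^ (2 - p) <= s ^ (2 - p)].
    Integrated over a bounded time interval, this replaces Hoelder's inequality. *)
Lemma sqr_le_powR (p s y : R) : 2 < p -> 0 < s -> 0 <= y ->
  y ^+ 2 <= s ^+ 2 + s `^ (2 - p) * y `^ p.
Proof.
move=> p2 s0 y0; have [ys|sy] := leP y s.
  apply: (@le_trans _ _ (s ^+ 2)); first by rewrite ler_pXn2r ?nnegrE// ltW.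
  by rewrite lerDl mulr_ge0 ?powR_ge0.
have yp : 0 < y by exact: lt_trans sy.
have -> : y `^ p = y ^+ 2 * y `^ (p - 2).
  by rewrite -powR_mulrn// -powRD ?subrKC// (gt_eqF yp) implybT.
apply: (@le_trans _ _ (s `^ (2 - p) * (y ^+ 2 * y `^ (p - 2)))); last first.
  by rewrite lerDr sqr_ge0.
rewrite mulrCA -[leLHS]mulr1 ler_wpM2l ?sqr_ge0//.
have E : 1 = s `^ (2 - p) * s `^ (p - 2).
  by rewrite -powRD ?(gt_eqF s0) ?implybT// addrA subrK subrr powRr0.
rewrite [leLHS]E ler_wpM2l ?powR_ge0// ge0_ler_powR// ?nnegrE ?(ltW s0) ?(ltW sy)//.
by rewrite subr_ge0 ltW.
Qed.

Lemma sqr_le_poweR (p s : R) (x : \bar R) : 2 < p -> 0 < s -> (0 <= x)%E ->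
  (x `^ 2 <= (s ^+ 2)%:E + (s `^ (2 - p))%:E * x `^ p)%E.
Proof.
move=> p2 s0; case: x => [y| |]//; last first.
  move=> _; rewrite !poweRyr//; last by rewrite gt_eqF// (lt_trans _ p2).
  by rewrite gt0_muley ?lte_fin ?powR_gt0// leey.
rewrite lee_fin => y0; rewrite !poweR_EFin -EFinM -EFinD lee_fin.
by rewrite powR_mulrn// sqr_le_powR.
Qed.

End interpolation.

Section time_dependent.
Variables (R : realType) (n : nat) (u : R -> 'rV[R]_n -> 'rV[R]_n).
Hypothesis mfu : measurable_fun [set: (R * 'rV[R]_n)%type] (fun z => u z.1 z.2).

Lemma measurable_fun_slice t : measurable_fun setT (u t).
Proof. exact: (measurableT_comp mfu (pair1_measurable t)). Qed.

Lemma measurable_energy : measurable_fun [set: R] (fun t => energy (u t)).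
Proof.
apply: (@measurable_fun_fubini_tonelli_F _ _ _ _ _ (lebesgue_rV R n)
  (fun z : R * 'rV[R]_n => (dot (u z.1 z.2) (u z.1 z.2))%:E)).
  by apply/measurable_EFinP; exact: measurable_dot.
by move=> z; rewrite lee_fin dotxx_ge0.
Qed.

Lemma L2norm_energy v : L2norm v = (@energy R n v `^ 2^-1)%E.
Proof. by rewrite energyE -poweRrM mulfV// poweRe1// L2norm_ge0. Qed.

Lemma measurable_L2norm_power p :
  measurable_fun [set: R] (fun t => L2norm (u t) `^ p)%E.
Proof.
apply: (measurableT_comp (measurable_poweR _)).
rewrite (_ : (fun _ => _) = fun t => (energy (u t) `^ 2^-1)%E).
  exact: (measurableT_comp (measurable_poweR _) measurable_energy).
by apply/funext => t; rewrite L2norm_energy.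
Qed.

Lemma le_integral_L2norm_power p M : 0 < p -> (LpL2_norm p%:E u <= M%:E)%E ->
  (\int[@lebesgue_measure R]_(t in `]0%R, +oo[%classic) (L2norm (u t) `^ p) <= (M `^ p)%:E)%E.
Proof.
move=> p0 uM.
apply: (@le_trans _ _ (LpL2_norm p%:E u `^ p)%E); last first.
  rewrite -poweR_EFin; apply: (gt0_ler_poweR (ltW p0)) => //;
    rewrite in_itv/= leey andbT ?Lnorm_ge0//.
  by rewrite (le_trans _ uM)// Lnorm_ge0.
rewrite /LpL2_norm powR_Lnorm ?gt_eqF//.
rewrite [leLHS](@eq_measure_integral _ _ _ _ (@lebesgue_pos R)); last first.
  by move=> A mA A0; rewrite /= /mrestr setIidl.
have E : (fun t => L2norm (u t) `^ p)%E = (fun t => `|(@L2norm R n \o u) t| `^ p)%E.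
  by apply/funext => t; rewrite /= gee0_abs// L2norm_ge0.
have mE := measurable_L2norm_power p.
rewrite E in mE *.
apply: ge0_subset_integral => //.
by move=> t _; exact: poweR_ge0.
Qed.

Lemma measurable_Rintegral (H : R -> 'rV[R]_n -> R) :
  measurable_fun [set: (R * 'rV[R]_n)%type] (fun z => H z.1 z.2) ->
  measurable_fun [set: R] (fun t => \int[lebesgue_rV R n]_x H t x).
Proof.
move=> mH.
have mE : measurable_fun [set: (R * 'rV[R]_n)%type] (fun z => (H z.1 z.2)%:E).
  exact/measurable_EFinP.
pose E z : \bar R := (H z.1 z.2)%:E.
pose Fp t := (\int[lebesgue_rV R n]_x (E^\+ (t, x)))%E.
pose Fn t := (\int[lebesgue_rV R n]_x (E^\- (t, x)))%E.
have mp : measurable_fun [set: R] Fp.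
  apply: (@measurable_fun_fubini_tonelli_F _ _ _ _ _ (lebesgue_rV R n) E^\+%E).
    exact: measurable_funepos.
  exact: funepos_ge0.
have mn : measurable_fun [set: R] Fn.
  apply: (@measurable_fun_fubini_tonelli_F _ _ _ _ _ (lebesgue_rV R n) E^\-%E).
    exact: measurable_funeneg.
  exact: funeneg_ge0.
have mG : measurable_fun [set: R] (fun t => \int[lebesgue_rV R n]_x (H t x)%:E)%E.
  have -> : (fun t => \int[lebesgue_rV R n]_x (H t x)%:E)%E = (Fp \- Fn)%E.
    by apply/funext => t; rewrite [LHS]integralE; congr (_ - _)%E; apply: eq_integral => x _;
      rewrite ?funeposE ?funenegE.
  exact: emeasurable_funB.
exact: measurableT_comp (fine_measurable measurableT) mG.
Qed.

End time_dependent.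

(** * The bound on the weak formulation *)

Section weak_form_bound.
Variables (R : realType) (n : nat) (i0 i1 : 'I_n) (u : R -> 'rV[R]_n -> 'rV[R]_n).
Hypotheses (i01 : i0 != i1)
  (mfu : measurable_fun [set: (R * 'rV[R]_n)%type] (fun z => u z.1 z.2)).
Variables (kappa L tau : R).
Hypotheses (kappa0 : 0 <= kappa) (L0 : 0 < L) (tau0 : 0 < tau).
Hypothesis energy1 : energy (vortex i0 i1 kappa L) = 1%E.

Let phi := test_field i0 i1 kappa L tau.

(** The space-time integrand of [weak_form] for the test field. *)
Definition weak_integrand t x : R := dot (u t x) (partial_t phi (x, t)) +
  \sum_i \sum_j u t x 0 i * u t x 0 j * partial_x j phi (x, t) 0 i.

Lemma weak_integrandE t x : weak_integrand t x =
  dtime_cutoff tau t * dot (u t x) (vortex i0 i1 kappa L x) +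
  time_cutoff tau t * \sum_i \sum_j u t x 0 i * u t x 0 j *
    dvortex i0 i1 kappa L i (delta_mx 0 j) x.
Proof.
rewrite /weak_integrand partial_t_test_field// dotZr.
congr (_ + _); rewrite mulr_sumr; apply: eq_bigr => i _; rewrite mulr_sumr; apply: eq_bigr => j _.
by rewrite partial_x_test_field// mulrCA.
Qed.

Lemma measurable_time_cutoff : measurable_fun [set: R] (time_cutoff tau).
Proof.
apply: continuous_measurable_fun => t; apply: differentiable_continuous.
by apply: differentiable_elem; exact: elem_time_cutoff.
Qed.

Lemma measurable_dtime_cutoff : measurable_fun [set: R] (dtime_cutoff tau).
Proof.
apply: continuous_measurable_fun => t; apply: differentiable_continuous.
apply: differentiable_elem.
rewrite (_ : dtime_cutoff tau = 'D_1 (time_cutoff tau)).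
  by apply: elem_derive; exact: elem_time_cutoff.
by apply/funext => s; apply/esym/derive_val/is_derive_time_cutoff.
Qed.

Lemma measurable_dvortex i v :
  measurable_fun [set: 'rV[R]_n] (dvortex i0 i1 kappa L i v).
Proof.
apply: continuous_measurable_rV => x; apply: differentiable_continuous.
apply: differentiable_elem.
rewrite (_ : dvortex _ _ _ _ _ _ = 'D_v (fun x => vortex i0 i1 kappa L x 0 i)).
  exact/elem_derive/elem_vortex.
by apply/funext => y; apply/esym/derive_val/is_derive_vortex.
Qed.

Lemma measurable_weak_integrand :
  measurable_fun [set: (R * 'rV[R]_n)%type] (fun z => weak_integrand z.1 z.2).
Proof.
have m1 (f : R -> R) : measurable_fun setT f ->
    measurable_fun [set: (R * 'rV[R]_n)%type] (fun z => f z.1).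
  by move=> mf; exact: measurableT_comp mf measurable_fst.
have m2 (f : 'rV[R]_n -> R) : measurable_fun setT f ->
    measurable_fun [set: (R * 'rV[R]_n)%type] (fun z => f z.2).
  by move=> mf; exact: measurableT_comp mf measurable_snd.
have mui i : measurable_fun [set: (R * 'rV[R]_n)%type] (fun z => u z.1 z.2 0 i).
  exact: measurableT_comp (@measurable_rV_coord R n i) mfu.
rewrite (_ : (fun _ => _) = fun z : R * 'rV[R]_n =>
  dtime_cutoff tau z.1 * dot (u z.1 z.2) (vortex i0 i1 kappa L z.2) +
  time_cutoff tau z.1 * \sum_i \sum_j u z.1 z.2 0 i * u z.1 z.2 0 j *
    dvortex i0 i1 kappa L i (delta_mx 0 j) z.2); last first.
  by apply/funext => z; rewrite weak_integrandE.
apply: measurable_funD.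
  apply: measurable_funM; first exact: m1 measurable_dtime_cutoff.
  apply: measurable_dot => //.
  exact: measurableT_comp (@measurable_vortex _ _ i0 i1 kappa L) measurable_snd.
apply: measurable_funM; first exact: m1 measurable_time_cutoff.
apply: measurable_sum => i; apply: measurable_sum => j.
apply: measurable_funM; last exact: m2 (@measurable_dvortex _ _).
by apply: measurable_funM; exact: mui.
Qed.

Let N : R := n%:R ^+ 2 * (5 * kappa).

Let N0 : 0 <= N. Proof. by rewrite !mulr_ge0// sqr_ge0. Qed.

Lemma normr_weak_integrand a t x : 0 < a -> `|weak_integrand t x| <=
  (`|dtime_cutoff tau t| * (a / 2)) * dot (vortex i0 i1 kappa L x) (vortex i0 i1 kappa L x) +
  (`|dtime_cutoff tau t| * (2 * a)^-1 + time_cutoff tau t * N) * dot (u t x) (u t x).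
Proof.
move=> a0; rewrite weak_integrandE (le_trans (ler_normD _ _))//.
rewrite !normrM [X in _ <= _ + X]mulrDl addrA -[X in X + _ <= _]addr0 lerD//.
  by rewrite addr0 -(mulrA _ (a / 2)) -(mulrA _ (2 * a)^-1) -mulrDr ler_wpM2l// dot_young.
rewrite (ger0_norm (time_cutoff_ge0 _ _)) -mulrA ler_wpM2l ?time_cutoff_ge0//.
by apply: normr_quadratic_le => i j; exact: normr_dvortex_le.
Qed.

Lemma normr_Rintegral_weak_integrand a t : 0 < a ->
  (`|\int[lebesgue_rV R n]_x weak_integrand t x|%:E <=
   (`|dtime_cutoff tau t| * (a / 2))%:E +
   (`|dtime_cutoff tau t| * (2 * a)^-1 + time_cutoff tau t * N)%:E * energy (u t))%E.
Proof.
move=> a0.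
have mvv (v : 'rV[R]_n -> 'rV[R]_n) : measurable_fun setT v ->
    measurable_fun setT (fun x => (dot (v x) (v x))%:E).
  by move=> mv; apply/measurable_EFinP; exact: measurable_dot.
have mut := measurable_fun_slice mfu t.
have mvo := @measurable_vortex _ _ i0 i1 kappa L.
have mH : measurable_fun setT (fun x => (weak_integrand t x)%:E).
  apply/measurable_EFinP.
  exact: (measurableT_comp measurable_weak_integrand (pair1_measurable t)).
set c1 := _ * (a / 2); set c2 := _ + _ * N.
have c10 : 0 <= c1 by rewrite !mulr_ge0// ltW// ?invr_gt0.
have c20 : 0 <= c2.
  by rewrite addr_ge0 ?mulr_ge0 ?time_cutoff_ge0// invr_ge0 mulr_ge0// ltW.
apply: (@le_trans _ _ (\int[lebesgue_rV R n]_x `|(weak_integrand t x)%:E|)%E).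
  apply: (le_trans _ (le_abse_integral _ measurableT mH)).
  rewrite /Rintegral; case: (integral _ _ _) => [r| |] //=.
  - by rewrite normr0 leey.
  - by rewrite normr0 leey.
rewrite -[X in (X + _)%E]mule1 -energy1 /energy -!ge0_integralZl_EFin//;
  try by move=> x _; rewrite lee_fin dotxx_ge0.
- rewrite -ge0_integralD//; last 4 first.
  + by move=> x _; rewrite -EFinM lee_fin mulr_ge0// dotxx_ge0.
  + by apply: measurable_funeM; exact: mvv.
  + by move=> x _; rewrite -EFinM lee_fin mulr_ge0// dotxx_ge0.
  + by apply: measurable_funeM; exact: mvv.
  apply: ge0_le_integral => //.
  + exact: measurableT_comp.
  + by apply: emeasurable_funD; apply: measurable_funeM; exact: mvv.
  + by move=> x _; rewrite -!EFinM -EFinD lee_fin normr_weak_integrand.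
- exact: mvv.
- exact: mvv.
Qed.

(** Here [a] is the weight in Young's inequality for [u . psi] and [s] the threshold in
    [sqr_le_powR]; the threshold [1] is used for the quadratic term. *)
Lemma weak_integral_le (p M a s : R) : 2 < p -> 0 < a -> 0 < s ->
  (LpL2_norm p%:E u <= M%:E)%E ->
  `|\int[@lebesgue_measure R]_(t in `]0, +oo[%classic)
     \int[lebesgue_rV R n]_x weak_integrand t x| <=
  (2 * a / tau + 2 / (a * tau) * s ^+ 2 + N) * tau +
  (2 / (a * tau) * s `^ (2 - p) + N) * M `^ p.
Proof.
move=> p2 a0 s0 uM; have p0 : 0 < p by exact: lt_trans p2.
pose F (t : R) : R := \int[lebesgue_rV R n]_x weak_integrand t x.
set C0 := _ + N; set C1 := _ + N.
have C00 : 0 <= C0.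
  by rewrite /C0 !addr_ge0// ?mulr_ge0 ?invr_ge0 ?mulr_ge0// ?sqr_ge0// ltW.
have C10 : 0 <= C1.
  by rewrite /C1 !addr_ge0// ?mulr_ge0 ?invr_ge0 ?mulr_ge0 ?powR_ge0// ltW.
have mF : measurable_fun [set: R] F.
  exact: measurable_Rintegral measurable_weak_integrand.
have mG := measurable_L2norm_power mfu p.
pose D := `]0, +oo[%classic : set R.
have mD : measurable D by exact: measurable_itv.
have bound t : D t -> (`|F t|%:E <=
    C0%:E * (\1_(`]0, tau[%classic : set R) t)%:E + C1%:E * (L2norm (u t) `^ p))%E.
  rewrite /D /= in_itv/= andbT => t0.
  have [taut|ttau] := leP tau t.
    have tn : tau <= `|t| by rewrite gtr0_norm.
    apply: le_trans (normr_Rintegral_weak_integrand t a0) _.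
    rewrite dtime_cutoff_out// time_cutoff_out// normr0 !mul0r addr0 mul0e adde0.
    by rewrite adde_ge0// mule_ge0 ?lee_fin ?poweR_ge0.
  apply: le_trans (normr_Rintegral_weak_integrand t a0) _.
  rewrite indicE mem_set ?mule1; last by rewrite /= in_itv/= t0.
  have hd := normr_dtime_cutoff tau0 t.
  have G0 : (0 <= L2norm (u t) `^ p)%E by exact: poweR_ge0.
  have E0 : (0 <= energy (u t))%E by exact: energy_ge0.
  have e1 : (energy (u t) <= (s ^+ 2)%:E + (s `^ (2 - p))%:E * L2norm (u t) `^ p)%E.
    by rewrite energyE; apply: sqr_le_poweR => //; exact: L2norm_ge0.
  have e2 : (energy (u t) <= 1 + L2norm (u t) `^ p)%E.
    have := sqr_le_poweR p2 ltr01 (L2norm_ge0 (u t)).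
    by rewrite energyE expr1n powR1 mul1e.
  have h1 : `|dtime_cutoff tau t| * (a / 2) <= 2 * a / tau.
    rewrite (_ : 2 * a / tau = (4 / tau) * (a / 2)); last by field; rewrite gt_eqF.
    by rewrite ler_wpM2r// divr_ge0// ltW.
  have h2 : `|dtime_cutoff tau t| * (2 * a)^-1 <= 2 / (a * tau).
    rewrite (_ : 2 / (a * tau) = (4 / tau) * (2 * a)^-1); last by field; rewrite !gt_eqF.
    by rewrite ler_wpM2r// invr_ge0 mulr_ge0// ltW.
  have h3 : time_cutoff tau t * N <= N.
    by rewrite ler_piMl// time_cutoff_le1.
  set A1 := 2 / (a * tau) in h2 *.
  have A10 : 0 <= A1 by rewrite divr_ge0// mulr_ge0 ?ltW.
  apply: (@le_trans _ _ ((2 * a / tau)%:E + (A1%:E * energy (u t) + N%:E * energy (u t)))%E).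
    rewrite leeD ?lee_fin// -ge0_muleDl// lee_wpmul2r// -EFinD lee_fin.
    exact: lerD.
  apply: (@le_trans _ _ ((2 * a / tau)%:E +
      (A1%:E * ((s ^+ 2)%:E + (s `^ (2 - p))%:E * L2norm (u t) `^ p) +
       N%:E * (1 + L2norm (u t) `^ p)))%E).
    by rewrite leeD2l// leeD// lee_wpmul2l.
  rewrite le_eqVlt; apply/orP; left; apply/eqP.
  rewrite /C0 /C1 -/A1; move: (L2norm (u t) `^ p)%E G0 => G G0.
  rewrite ge0_muleDr ?mule_ge0 ?lee_fin ?sqr_ge0 ?powR_ge0//.
  rewrite ge0_muleDr// mule1 muleA -!EFinM.
  have A1s : 0 <= A1 * s `^ (2 - p) by exact: mulr_ge0 (powR_ge0 _ _).
  rewrite (EFinD (A1 * _) N) ge0_muleDl ?lee_fin//.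
  rewrite (EFinD (_ + _) N) (EFinD (2 * a / tau)) -!addeA; congr (_ + (_ + _))%E.
  by rewrite addeCA.
have mB : measurable_fun [set: R] (fun t => C0%:E * (\1_(`]0, tau[%classic : set R) t)%:E +
    C1%:E * (L2norm (u t) `^ p))%E.
  apply: emeasurable_funD; last exact: measurable_funeM.
  apply: measurable_funeM; apply/measurable_EFinP.
  exact: measurable_indic.
rewrite -lee_fin.
apply: (@le_trans _ _ (\int[@lebesgue_measure R]_(t in D) `|(F t)%:E|)%E).
  have mFE : measurable_fun D (EFin \o F).
    by apply/measurable_EFinP; exact: measurable_funTS.
  have h := le_abse_integral (@lebesgue_measure R) mD mFE; apply: le_trans h.
  rewrite /Rintegral; case: (integral _ _ _) => [r| |] //=.
  - by rewrite normr0 leey.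
  - by rewrite normr0 leey.
apply: (@le_trans _ _ (\int[@lebesgue_measure R]_(t in D)
    (C0%:E * (\1_(`]0, tau[%classic : set R) t)%:E +
    C1%:E * (L2norm (u t) `^ p)))%E).
  apply: ge0_le_integral => //.
  - apply: measurableT_comp => //; apply/measurable_EFinP; exact: measurable_funTS.
  - exact: measurable_funTS.
rewrite ge0_integralD//; last 4 first.
- by move=> t _; rewrite mule_ge0 ?lee_fin.
- by apply: measurable_funeM; apply/measurable_EFinP; exact: measurable_indic.
- by move=> t _; rewrite mule_ge0 ?lee_fin ?poweR_ge0.
- by apply: measurable_funeM; exact: measurable_funTS.
rewrite (EFinD (C0 * tau)); apply: leeD.
  rewrite ge0_integralZl_EFin//; last by apply/measurable_EFinP; exact: measurable_indic.
  rewrite EFinM lee_wpmul2l// integral_indic//.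
  apply: (@le_trans _ _ ((@lebesgue_measure R) `]0, tau[%classic)).
    by apply: le_measure; rewrite ?inE//; exact: measurableI.
  by rewrite lebesgue_measure_itv/= lte_fin tau0 oppr0 adde0.
rewrite ge0_integralZl_EFin//; last 2 first.
- by move=> t _; exact: poweR_ge0.
- exact: measurable_funTS.
rewrite EFinM lee_wpmul2l//.
exact: le_integral_L2norm_power.
Qed.

End weak_form_bound.

(** * Elements of L^2_sigma and their representatives *)

Section L2sigma_representatives.
Variables (R : realType) (n : nat).
Implicit Types f g : 'rV[R]_n -> 'rV[R]_n.

Lemma energyZ k f : measurable_fun setT f ->
  energy (fun x => k *: f x) = ((k ^+ 2)%:E * energy f)%E.
Proof.
move=> mf; rewrite /energy -ge0_integralZl_EFin ?sqr_ge0//.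
- by apply: eq_integral => x _; rewrite dotZl dotZr -EFinM mulrA expr2.
- by move=> x _; rewrite lee_fin dotxx_ge0.
- by apply/measurable_EFinP; exact: measurable_dot.
Qed.

Lemma ae_energy f g : measurable_fun setT f -> measurable_fun setT g ->
  {ae lebesgue_rV R n, forall x, f x = g x} -> energy f = energy g.
Proof.
move=> mf mg fg; apply: ge0_ae_eq_integral => //.
- by apply/measurable_EFinP; exact: measurable_dot.
- by apply/measurable_EFinP; exact: measurable_dot.
- by move=> x _; rewrite lee_fin dotxx_ge0.
- by move=> x _; rewrite lee_fin dotxx_ge0.
- by apply: filterS fg => x -> _.
Qed.

Lemma ae_pairing f g (h : 'rV[R]_n -> 'rV[R]_n) :
  measurable_fun setT f -> measurable_fun setT g -> measurable_fun setT h ->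
  {ae lebesgue_rV R n, forall x, f x = g x} ->
  \int[lebesgue_rV R n]_x dot (f x) (h x) = \int[lebesgue_rV R n]_x dot (g x) (h x).
Proof.
move=> mf mg mh fg; rewrite /Rintegral; congr fine; apply: ae_eq_integral => //.
- by apply/measurable_EFinP; exact: measurable_dot.
- by apply/measurable_EFinP; exact: measurable_dot.
- by apply: filterS fg => x -> _.
Qed.

(** Testing the divergence against [eta] is pairing with a field of finite energy. *)
Lemma test_gradient (eta : 'rV[R]_n -> R) : smooth eta -> compact_support eta ->
  exists grad : 'rV[R]_n -> 'rV[R]_n, [/\ measurable_fun setT grad,
    (energy grad < +oo)%E & forall f,
    \int[lebesgue_rV R n]_x \sum_i f x 0 i * 'D_(delta_mx 0 i) eta x =
    \int[lebesgue_rV R n]_x dot (f x) (grad x)].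
Proof.
move=> seta ceta; pose grad (x : 'rV[R]_n) : 'rV[R]_n := \row_i 'D_(delta_mx 0 i) eta x.
have cgrad i : continuous (fun x => grad x 0 i).
  rewrite (_ : (fun _ => _) = 'D_(delta_mx 0 i) eta); last first.
    by apply/funext => x; rewrite mxE.
  by move=> x; apply: differentiable_continuous; exact: (seta [:: delta_mx 0 i]).
exists grad; split.
- by apply: measurable_fun_rV => i; exact: continuous_measurable_rV.
- have [b b0 eta0] := compact_support_box ceta.
  have bb : - b <= b by rewrite (le_trans _ b0)// oppr_le0.
  apply: integrable_lty => //.
  apply: (integrable_continuous_box bb).
    move=> x; apply: differentiable_continuous.
    rewrite (_ : (fun _ => _) = \sum_i (('D_(delta_mx 0 i) eta) * ('D_(delta_mx 0 i) eta))).
      apply: differentiable_sum => i.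
      by apply: differentiableM; exact: (seta [:: delta_mx 0 i]).
    by apply/funext => y; rewrite fct_sumE; apply: eq_bigr => i _; rewrite mxE.
  move=> x /eta0 near0; rewrite /dot big1// => i _.
  rewrite mxE (@near_eq_derive _ _ _ _ (cst 0))// ?derive_cst ?mulr0//.
- by move=> f; apply: eq_Rintegral => x _; apply: eq_bigr => i _; rewrite mxE.
Qed.

Lemma ae_div_free f g : measurable_fun setT f -> measurable_fun setT g ->
  {ae lebesgue_rV R n, forall x, f x = g x} -> div_free f -> div_free g.
Proof.
move=> mf mg fg df eta seta ceta.
have [grad [mgrad _ gradE]] := test_gradient seta ceta.
by rewrite gradE -(ae_pairing mf mg mgrad fg) -gradE; exact: df.
Qed.

Lemma pairingDZ f g h k : measurable_fun setT f -> measurable_fun setT g ->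
  measurable_fun setT h ->
  (energy f < +oo)%E -> (energy g < +oo)%E -> (energy h < +oo)%E ->
  \int[lebesgue_rV R n]_x dot (f x + k *: g x) (h x) =
  \int[lebesgue_rV R n]_x dot (f x) (h x) + k * \int[lebesgue_rV R n]_x dot (g x) (h x).
Proof.
move=> mf mg mh fy gy hy.
have ifh := integrable_dot mf mh fy hy; have igh := integrable_dot mg mh gy hy.
rewrite -RintegralZl// -RintegralD//.
  by apply: eq_Rintegral => x _; rewrite dotDl dotZl.
exact: (integrableZl measurableT k igh).
Qed.

Lemma div_freeDZ f g k : measurable_fun setT f -> measurable_fun setT g ->
  (energy f < +oo)%E -> (energy g < +oo)%E -> div_free f -> div_free g ->
  div_free (fun x => f x + k *: g x).
Proof.
move=> mf mg fy gy df dg eta seta ceta.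
have [grad [mgrad grady gradE]] := test_gradient seta ceta.
rewrite gradE pairingDZ// -!gradE.
by rewrite (df _ seta ceta) (dg _ seta ceta) mulr0 addr0.
Qed.

Lemma L2sigma_of_fun f : measurable_fun setT f -> (energy f < +oo)%E -> div_free f ->
  exists w : L2sigma R n, {ae lebesgue_rV R n, forall x, f x = w x}.
Proof.
move=> mf fy df.
pose fm := MeasurableFun.Pack (MeasurableFun.Class (isMeasurableFun.Build _ _ _ _ f mf)).
pose w : {mfun_(lebesgue_rV R n), 'rV[R]_n >-> 'rV[R]_n} := (\pi fm)%qT.
have fw : {ae lebesgue_rV R n, forall x, f x = w x}.
  pose r := repr w; have : w = (\pi r)%qT by rewrite reprK.
  by move=> /eqmodP/asboolP; apply: filterS => x /(_ Logic.I).
have mw : measurable_fun setT w by rewrite /= /aqEqMfun_to_fun.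
have wy : (L2norm w < +oo)%E.
  by rewrite L2norm_energy -(ae_energy mf mw fw) poweR_lty.
by exists (MkL2sigma wy (ae_div_free mf mw fw df)).
Qed.

Lemma energy_L2sigma (v : L2sigma R n) : (energy v < +oo)%E.
Proof. exact/energy_lty/L2sigma_norm. Qed.

Lemma energyB_lty (v w : L2sigma R n) : (energy (fun x => (v x - w x)%R) < +oo)%E.
Proof.
apply: energy_lty.
have m0 : measurable_fun [set: 'rV[R]_n] (fun _ => 0 : 'rV[R]_n).
  exact: measurable_cst.
apply: le_lt_trans (L2normB (measurable_L2sigma v) m0 (measurable_L2sigma w)) _.
apply: lte_add_pinfty.
  rewrite (_ : (fun x => v x - 0) = v); first exact: L2sigma_norm.
  by apply/funext => x; rewrite subr0.
rewrite (_ : L2norm _ = L2norm w); first exact: L2sigma_norm.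
by congr Lnorm; apply/funext => x /=; rewrite sub0r enormN.
Qed.

Lemma energyB_dist (v w : L2sigma R n) :
  energy (fun x => v x - w x) = (L2sigma_dist v w ^+ 2)%:E.
Proof.
have := energyB_lty v w; rewrite energyE => h.
have {}h : L2norm (fun x => (v x - w x)%R) \is a fin_num.
  by rewrite ge0_fin_numE ?L2norm_ge0//; exact: lty_poweRy h.
have d0 : 0 <= L2sigma_dist v w by exact: fine_ge0 (L2norm_ge0 _).
by rewrite -(fineK h) poweR_EFin -/(L2sigma_dist v w) powR_mulrn.
Qed.

Lemma ball_L2sigma (v w : L2sigma R n) r : ball v r w <-> L2sigma_dist v w < r.
Proof. by []. Qed.

Lemma normr_pairingB_le (v w : L2sigma R n) f d : measurable_fun setT f ->
  energy f = 1%E -> L2sigma_dist v w <= d -> 0 < d ->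
  `|\int[lebesgue_rV R n]_x dot (v x) (f x) - \int[lebesgue_rV R n]_x dot (w x) (f x)| <= d.
Proof.
move=> mf f1 vwd d0.
have mv := measurable_L2sigma v; have mw := measurable_L2sigma w.
have fy : (energy f < +oo)%E by rewrite f1 ltry.
rewrite -RintegralB//; last 2 first.
- exact: integrable_dot mv mf (energy_L2sigma v) fy.
- exact: integrable_dot mw mf (energy_L2sigma w) fy.
have mvw := measurable_rVB mv mw.
rewrite (_ : (fun _ => _) = fun x => dot (v x - w x) (f x)); last first.
  apply/funext => x; rewrite dotDl; congr (_ + _); rewrite dotNl.
  by [].
have i := integrable_dot mvw mf (energyB_lty v w) fy.
apply: le_trans (le_normr_Rintegral _ i) _ => //.
rewrite -lee_fin fineK; last first.
  by have := integrable_norm i; move/(integrable_fin_num measurableT).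
have := ge0_integral_dot mvw mf d0; rewrite f1 mule1 => /le_trans; apply.
rewrite energyB_dist -EFinM -EFinD lee_fin.
have h : L2sigma_dist v w ^+ 2 <= d ^+ 2.
  by rewrite ler_pXn2r// nnegrE ?(ltW d0)// fine_ge0// L2norm_ge0.
apply: (@le_trans _ _ (d / 2 + (2 * d)^-1 * d ^+ 2)).
  by rewrite lerD2l ler_wpM2l// invr_ge0 mulr_ge0// ltW.
by rewrite le_eqVlt; apply/orP; left; apply/eqP; field; rewrite gt_eqF.
Qed.

Lemma L2sigma_add_scaled (v : L2sigma R n) f k : measurable_fun setT f ->
  energy f = 1%E -> div_free f -> 0 <= k ->
  exists w : L2sigma R n, L2sigma_dist v w = k /\
    \int[lebesgue_rV R n]_x dot (w x) (f x) =
    \int[lebesgue_rV R n]_x dot (v x) (f x) + k.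
Proof.
move=> mf f1 df k0.
have fy : (energy f < +oo)%E by rewrite f1 ltry.
have mv := measurable_L2sigma v.
have mkf : measurable_fun setT (fun x => k *: f x).
  apply: measurable_fun_rV => i.
  rewrite (_ : (fun _ => _) = fun x => k * rV_coord i (f x)); last first.
    by apply/funext => x; rewrite mxE.
  apply: measurable_funM => //.
  exact: measurableT_comp (@measurable_rV_coord R n i) mf.
pose g x := v x + k *: f x.
have mg : measurable_fun setT g.
  rewrite (_ : g = fun x => v x - - (k *: f x)).
    by apply: measurable_rVB => //; exact: measurable_rVN.
  by apply/funext => x; rewrite opprK.
have gy : (energy g < +oo)%E.
  apply: energy_lty; rewrite (_ : g = fun x => v x - - (k *: f x)); last first.
    by apply/funext => x; rewrite opprK.
  have m0 : measurable_fun [set: 'rV[R]_n] (fun _ => 0 : 'rV[R]_n).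
    exact: measurable_cst.
  apply: le_lt_trans (L2normB mv m0 (measurable_rVN mkf)) _.
  rewrite (_ : (fun x => v x - 0) = v); last by apply/funext => x; rewrite subr0.
  rewrite (_ : (fun x => 0 - - (k *: f x)) = fun x => k *: f x); last first.
    by apply/funext => x; rewrite sub0r opprK.
  rewrite lte_add_pinfty ?L2sigma_norm// L2norm_energy poweR_lty// energyZ//.
  by rewrite lte_mul_pinfty// lee_fin sqr_ge0.
have dg : div_free g.
  exact: (div_freeDZ k mv mf (energy_L2sigma v) fy (@L2sigma_div _ _ v) df).
have [w gw] := L2sigma_of_fun mg gy dg.
have mw := measurable_L2sigma w.
exists w; split.
  have E : energy (fun x => v x - w x) = (k ^+ 2)%:E.
    rewrite -[RHS]mule1 -f1 -(sqrrN k) -energyZ//; apply: ae_energy.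
    - exact: measurable_rVB.
    - rewrite (_ : (fun x => - k *: f x) = fun x => - (k *: f x)).
        exact: measurable_rVN.
      by apply/funext => x; rewrite scaleNr.
    - apply: filterS gw => x <-.
      by rewrite /g opprD addrA subrr sub0r scaleNr.
  move: E; rewrite energyB_dist => -[] /eqP.
  rewrite eqrXn2// => [/eqP//|]; exact: fine_ge0 (L2norm_ge0 _).
rewrite -(ae_pairing mg mw mf gw).
rewrite pairingDZ//; last exact: energy_L2sigma.
have : (\int[lebesgue_rV R n]_x dot (f x) (f x))%:E = 1%E.
  rewrite fineK; first exact: f1.
  by rewrite -[X in X \is a fin_num]/(energy f) f1.
by move=> [->]; rewrite mulr1.
Qed.

End L2sigma_representatives.

(** * Nowhere dense and residual sets of data *)

Section admissible_data.
Variables (R : realType) (n : nat).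
Hypothesis n2 : (2 <= n)%N.

(** The data with a weak solution in the ball of radius [M] of L^p_t L^2_x. *)
Definition admissible_data (p M : R) : set (L2sigma R n) :=
  [set u0 : L2sigma R n | exists u : R -> 'rV[R]_n -> 'rV[R]_n,
     weak_solution u0 u /\ LpL2_ball p%:E M u].

(** A single unit field is nearly orthogonal to all the admissible data. *)
Lemma exists_small_pairing (p M d : R) : 2 < p -> 0 < M -> 0 < d ->
  exists psi : 'rV[R]_n -> 'rV[R]_n,
    [/\ measurable_fun setT psi, energy psi = 1%E, div_free psi &
     forall u0, admissible_data p M u0 ->
       `|\int[lebesgue_rV R n]_x dot (u0 x) (psi x)| <= d].
Proof.
move=> p2 M0 d0.
have n0 : (0 < n)%N by exact: ltnW.
pose i0 := Ordinal n0; pose i1 := Ordinal n2.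
have i01 : i0 != i1 by [].
pose chi0 : R := flat 1 1.
have chi0_gt0 : 0 < chi0 by exact: flat1_gt0.
(* With a = s = e, the four contributions to the bound of weak_integral_le are at most
   2 e, 2 e, 2 e and e, the third by the choice of tau and the last by that of eps. *)
pose e := d * chi0 / 10.
have e0 : 0 < e by rewrite divr_gt0// mulr_gt0.
pose X := e `^ (2 - p) * M `^ p.
have X0 : 0 <= X by rewrite mulr_ge0 ?powR_ge0.
pose tau := 1 + X / e ^+ 2.
have tau0 : 0 < tau by rewrite ltr_wpDr// divr_ge0// sqr_ge0.
have Xtau : X <= e ^+ 2 * tau.
  by rewrite /tau mulrDr mulr1 mulrCA mulfV ?mulr1 ?lerDr ?sqr_ge0// expf_neq0 ?gt_eqF.
pose Mp := M `^ p.
have Mp0 : 0 <= Mp by exact: powR_ge0.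
pose eps := e / (n%:R ^+ 2 * (tau + Mp)).
have nn0 : 0 < n%:R ^+ 2 :> R by rewrite exprn_gt0// ltr0n.
have tM0 : 0 < tau + Mp by rewrite ltr_wpDr.
have eps0 : 0 < eps by rewrite divr_gt0// mulr_gt0.
have [kappa [L [kappa0 L0 keps E1]]] := exists_normalized_vortex i01 eps0.
exists (vortex i0 i1 kappa L); split => //.
- exact: measurable_vortex.
- exact: div_free_vortex.
move=> u0 [u [[_ usol] [[mfu _] uM]]].
have := usol (test_field i0 i1 kappa L tau) (smooth_test_field i0 i1 kappa L tau)
  (@compact_support_test_field _ _ i0 i1 kappa L tau L0 tau0)
  (fun x t _ => div_x_test_field i01 kappa L tau x t).
rewrite /weak_form.
set A := \int[_]_(t in _) _; set B := \int[_]_x _ => /eqP; rewrite addrC addr_eq0 => /eqP BA.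
have BE : B = chi0 * \int[lebesgue_rV R n]_x dot (u0 x) (vortex i0 i1 kappa L x).
  rewrite /B -RintegralZl//.
    apply: eq_Rintegral => x _; rewrite /test_field /= dotZr; congr (_ * _).
    by rewrite /time_cutoff expr0n/= mulr0 subr0.
  apply: integrable_dot; [exact: measurable_L2sigma|exact: measurable_vortex| |].
    exact: energy_L2sigma.
  by rewrite /energy E1 ltry.
have := weak_integral_le i01 mfu kappa0 L0 tau0 E1 p2 e0 e0 uM.
rewrite -[X in `|X|]/A => hA.
have hB : `|B| <= 7 * e.
  rewrite BA normrN; apply: (le_trans hA).
  set N := _ * (5 * _); rewrite -/Mp.
  have hN : N * (tau + Mp) <= e.
    rewrite -ler_pdivlMr// /N -ler_pdivlMl// [leRHS](_ : _ = eps)//.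
    by rewrite /eps (invfM (n%:R ^+ 2)) mulrCA.
  have hX : 2 / (e * tau) * X <= 2 * e.
    rewrite -mulrA ler_wpM2l// mulrC ler_pdivrMr ?mulr_gt0//.
    by rewrite mulrA -expr2.
  rewrite [leLHS](_ : _ = 2 * e + 2 * e + 2 / (e * tau) * X + N * (tau + Mp)); first by lra.
  by rewrite /X -/Mp; field; rewrite !gt_eqF.
have : `|B| <= d * chi0 by apply: (le_trans hB); rewrite /e; have := mulr_gt0 d0 chi0_gt0; lra.
by rewrite BE normrM gtr0_norm// mulrC ler_pM2r.
Qed.

Lemma nowhere_dense_admissible_data (p M : R) : 2 < p -> 0 < M ->
  nowhere_dense (admissible_data p M).
Proof.
move=> p2 M0; apply/seteqP; split => // w /nbhs_ballP[r /= r0 wr].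
pose d := r / 16.
have d0 : 0 < d by rewrite divr_gt0.
have [psi [mpsi psi1 dpsi hA]] := exists_small_pairing p2 M0 d0.
pose T (v : L2sigma R n) := \int[lebesgue_rV R n]_x dot (v x) (psi x).
have hcl v : closure (admissible_data p M) v -> `|T v| <= 2 * d.
  move=> /(_ (ball v d) (nbhsx_ballx _ _ d0))[u0 [Au0 /ball_L2sigma/ltW vu0]].
  rewrite -(subrK (T u0) (T v)) (le_trans (ler_normD _ _))//.
  have -> : 2 * d = d + d by rewrite mulr_natl mulr2n.
  by rewrite lerD//; [exact: normr_pairingB_le mpsi psi1 vu0 d0|exact: hA].
have r2 : 0 <= r / 2 by rewrite divr_ge0// ltW.
have [w' [ww' Tw']] := L2sigma_add_scaled w mpsi psi1 dpsi r2.
have h1 : `|T w| <= 2 * d.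
  by apply: hcl; apply: wr; exact: ballxx.
have h2 : `|T w'| <= 2 * d.
  by apply: hcl; apply: wr; apply/ball_L2sigma; rewrite ww' ltr_pdivrMr// ltr_pMr// ltr1n.
have : T w' = T w + r / 2 by exact: Tw'.
move: h1 h2; rewrite !ler_norml /d => /andP[a1 a2] /andP[b1 b2] Tww; lra.
Qed.

(** For almost every time the L^2 norm [g] of [u t] is at most some [C >= 1], so that
    [g ^ q <= C ^ (q - p) * g ^ p]. *)
Lemma LpL2_higher (u : R -> 'rV[R]_n -> 'rV[R]_n) (p q : R) : 0 < p -> p <= q ->
  LpL2 +oo%E u -> LpL2 p%:E u -> LpL2 q%:E u.
Proof.
move=> p0 pq [mfu uy] [_ up]; split => //.
have q0 : 0 < q by exact: lt_le_trans pq.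
have mL (s : R) : measurable_fun [set: R] (fun t => `|(@L2norm R n \o u) t| `^ s)%E.
  rewrite (_ : (fun _ => _) = fun t => (L2norm (u t) `^ s)%E).
    exact: measurable_L2norm_power.
  by apply/funext => t; rewrite /= gee0_abs// L2norm_ge0.
have [C C1 uC] : exists2 C : R, 1 <= C &
    {ae @lebesgue_pos R, forall t, (`|(@L2norm R n \o u) t| <= C%:E)%E}.
  move: uy; rewrite /LpL2_norm unlock /Lnorm ifT; last first.
    by rewrite /= /mrestr setTI lebesgue_measure_itv/= ltry oppr0 adde0 ltry.
  set S := (X in (X < +oo)%E -> _) => Sy.
  exists (Num.max 1 (fine S)); first by rewrite le_max lexx.
  apply/ess_supP; rewrite -/S; move: Sy; case: S => [r| |]//= _.
  - by rewrite lee_fin le_max lexx orbT.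
  - by rewrite leNye.
have int_p : (\int[@lebesgue_pos R]_t (`|(@L2norm R n \o u) t| `^ p) < +oo)%E.
  by rewrite -powR_Lnorm ?gt_eqF// poweR_lty.
have int_q : (\int[@lebesgue_pos R]_t (`|(@L2norm R n \o u) t| `^ q) < +oo)%E.
  apply: (@le_lt_trans _ _ (\int[@lebesgue_pos R]_t
      ((C `^ (q - p))%:E * (`|(@L2norm R n \o u) t| `^ p)))%E); last first.
    rewrite ge0_integralZl_EFin ?powR_ge0//.
    - by rewrite lte_mul_pinfty ?lee_fin ?powR_ge0.
    - by move=> t _; exact: poweR_ge0.
    - exact: mL.
  apply: ae_ge0_le_integral => //.
  - by move=> t _; exact: poweR_ge0.
  - exact: mL.
  - by move=> t _; rewrite mule_ge0 ?lee_fin ?powR_ge0 ?poweR_ge0.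
  - exact: measurable_funeM (mL p).
  apply: (@filterS _ _ (ae_filter_ringOfSetsType (@lebesgue_pos R)) _ _ _ uC) => t uCt _.
  move: uCt.
  have := abse_ge0 ((@L2norm R n \o u) t).
  case: (abse ((@L2norm R n \o u) t)) => [y| |]//; rewrite !lee_fin => y0 yC.
  have -> : y `^ q = y `^ (q - p) * y `^ p.
    by rewrite -powRD ?subrK// (gt_eqF q0).
  rewrite ler_wpM2r ?powR_ge0// ge0_ler_powR ?nnegrE ?subr_ge0//.
  by rewrite (le_trans _ C1).
by rewrite /LpL2_norm unlock /Lnorm poweR_lty.
Qed.

Lemma residual_no_weak_solution : exists G : set (L2sigma R n), [/\ residual G, Gdelta G &
  forall u0 : L2sigma R n, G u0 ->
    ~ exists u : R -> 'rV[R]_n -> 'rV[R]_n,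
        [/\ weak_solution u0 u, LpL2 +oo%E u & exists p : R, 2 < p /\ LpL2 p%:E u]].
Proof.
(* The exponents are shifted by 3 to stay above 2, and the radii by 1 to stay positive. *)
pose B (z : nat * nat) := admissible_data z.1.+3%:R z.2.+1%:R.
pose A (k : nat) := if unpickle k is Some z then B z else set0.
have ndA k : nowhere_dense (A k).
  rewrite /A; case: (unpickle k) => [z|].
    by apply: nowhere_dense_admissible_data; rewrite ?ltr_nat ?ltr0n.
  by rewrite /nowhere_dense closure0 interior0.
exists (\bigcap_k ~` closure (A k)); split.
- exists (fun k => closure (A k)); split.
    move=> k; rewrite /nowhere_dense.
    by have /closure_id <- := @closed_closure _ (A k); exact: ndA.
  by rewrite setC_bigcap; apply: subset_bigcup => k _; rewrite setCK.
- exists (fun k => ~` closure (A k)) => // k.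
  by apply: closed_openC; exact: closed_closure.
move=> u0 Gu0 [u [usol uy [p [p2 up]]]].
have p0 : 0 < p by exact: lt_trans p2.
pose q := Num.truncn p.
have pq : p <= q.+3%:R.
  by apply: (le_trans (ltW (truncnS_gt p))); rewrite ler_nat ltnS leqW// leqnSn.
have [mfu uq] := LpL2_higher p0 pq uy up.
pose m := Num.truncn (fine (LpL2_norm q.+3%:R%:E u)).
have um : (LpL2_norm q.+3%:R%:E u <= m.+1%:R%:E)%E.
  have fu : LpL2_norm q.+3%:R%:E u \is a fin_num.
    by rewrite ge0_fin_numE// Lnorm_ge0.
  by rewrite -(fineK fu) lee_fin ltW// truncnS_gt.
apply: (Gu0 (pickle (q, m)) Logic.I); apply: subset_closure.
rewrite /A pickleK /B /=; exists u; split => //.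
Qed.

End admissible_data.

Theorem corollaryE (R : realType) (n : nat) (n2 : (2 <= n)%N) :
  (forall p M : R, 2 < p -> 0 < M ->
     nowhere_dense
       [set u0 : L2sigma R n | exists u : R -> 'rV[R]_n -> 'rV[R]_n,
          weak_solution u0 u /\ LpL2_ball p%:E M u]) /\
  (exists G : set (L2sigma R n), [/\ residual G, Gdelta G &
     forall u0 : L2sigma R n, G u0 ->
       ~ exists u : R -> 'rV[R]_n -> 'rV[R]_n,
           [/\ weak_solution u0 u, LpL2 +oo%E u &
               exists p : R, 2 < p /\ LpL2 p%:E u]]).
Proof.
split; last exact: residual_no_weak_solution.
by move=> p M; exact: nowhere_dense_admissible_data.
Qed.
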